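(* There are absolute constants $0<c<C$ and an integer $d_0$ such that for every fixed integer $d\ge d_0$, as $n\to\infty$ through integers with $nd$ even, $$\mathbb P\left(c\,\frac{n\log d}{d}\le L_{\mathrm{hole}}(G_{n,d})\le C\,\frac{n\log d}{d}\right)\to 1 .$$ That is, with high probability $L_{\mathrm{hole}}(G_{n,d})=\Theta\left(\frac{n\log d}{d}\right)$.
   Context: $G_{n,d}$ is a uniformly random (simple) $d$-regular graph on the vertex set $[n]=\{1,\dots,n\}$. For a graph $G$, $L_{\mathrm{hole}}(G)$ is the maximum number of vertices of an induced cycle in $G$. ''With high probability'' means with probability tending to $1$ as $n\to\infty$ ($d$ fixed). *)

(* Defs.v *)
From mathcomp Require Import all_boot all_order all_algebra.
From mathcomp Require Import reals.

Set Implicit Arguments.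
Unset Strict Implicit.
Unset Printing Implicit Defensive.

(* Simple graphs on n labelled vertices, given by their edge sets. *)
Definition sgraph (n : nat) : Type :=
  {E : {set {set 'I_n}} | [forall e in E, #|e| == 2]}.

Definition adj (n : nat) (G : sgraph n) : rel 'I_n :=
  fun x y => [set x; y] \in val G.

Definition degree (n : nat) (G : sgraph n) (x : 'I_n) : nat :=
  #|[set y | adj G x y]|.

Definition regular (n : nat) (G : sgraph n) (d : nat) : bool :=
  [forall x, degree G x == d].

(* The subgraph induced on S is a cycle: for some cyclic ordering c of S, two
   vertices of S are adjacent iff they are consecutive in c. *)
Definition induced_cycle (n : nat) (G : sgraph n) (S : {set 'I_n}) : bool :=
  (3 <= #|S|) &&
  [exists c : #|S|.-tuple 'I_n,
     [&& uniq c, [set x in c] == S &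
         [forall x in S, forall y in S,
            adj G x y == ((y == next c x) || (x == next c y))]]].

(* This is 0 when G is a forest. *)
Definition L_hole (n : nat) (G : sgraph n) : nat :=
  \max_(S : {set 'I_n} | induced_cycle G S) #|S|.

Local Open Scope ring_scope.

(* The probability that a uniformly random d-regular graph on n vertices
   satisfies P (0 by convention if there is no such graph). *)
Definition prob_regular (R : realType) (n d : nat)
    (P : pred (sgraph n)) : R :=
  #|[set G : sgraph n | regular G d && P G]|%:R /
  #|[set G : sgraph n | regular G d]|%:R.

(* Main.v *)
Require Import Defs.
From mathcomp Require Import all_boot all_order all_algebra.
From mathcomp Require Import zify.

(** Write [L = ln d]. Everything is a first moment computation: each of a few
    undesirable configurations of vertex sets has probability exponentially small
    in [n], with a rate that exceeds the entropy of the choice of the sets. The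
    probabilities are bounded by switchings performed directly on [d]-regular
    graphs: replacing two edges [ab], [ce] by [ac], [be] preserves regularity
    and is reversible, so double counting compares the sizes of two classes of
    graphs ([double_count]). No asymptotic enumeration of regular graphs is
    involved; it is only used that there is at least one
    ([exists_regular], a circulant graph).

    The main device ([slot_step]) resamples the neighbourhood of a vertex [w] one
    neighbour at a time by such switches. Treating the vertices of a set one after
    the other, it yields the two sharp estimates:
    - a given independent set [X] of size [a] has no edges to a given [Y] of size
      [b] with probability at most about [(1 - b / n) ^ (d * a)]
      ([count_isolated]);
    - a given set of size [r * n * L / d] leaves each other vertex undominated with
      probability at least about [d ^ (- 6 * r)], even conditionally on having
      dominated other vertices ([count_dominates]).
    A cruder estimate, obtained from two successive switches, handles pairs of
    arbitrary sets without edges between them ([count_separated]). The union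
    bound then shows that, with high probability,
    - there is no independent set of size [10 * n * L / d];
    - sets of size [n * L / (60 * d)] leave more than [d ^ (- 1 / 4) * n] vertices
      undominated, and any two disjoint sets of a third of that size are joined by
      an edge;
    - sets of size [n * L / (4096 * d)] leave more than [d ^ (- 1 / 512) * n]
      vertices undominated, and any third of that many vertices is joined by an
      edge to any disjoint independent set of size [n * L / (256 * d)].

    The upper bound follows from the first property, as every other vertex of a
    hole belongs to an independent set ([long_hole_isolated]). For the lower
    bound, depth first search with an induced path as its stack gets stuck only
    if it creates two large sets without edges between them, which the second
    property excludes; so there is an induced path of length of order [n * L / d]
    ([exists_ipath]). By the third property some vertex is adjacent to both end
    parts of this path and to nothing in its middle part, and it closes the middle
    part to an induced cycle ([long_hole]). The logarithm comes from domination: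
    a set of size [r * n * L / d] with small [r] misses a polynomially small
    proportion [d ^ (- O (r))] of the vertices, and such a number of vertices is
    still enough to find edges. *)

Set Implicit Arguments.
Unset Strict Implicit.
Unset Printing Implicit Defensive.

(** The form in which every switching is used: if the switching [f] can be
    performed in at least [k] ways from each element of [A], lands in [B], and
    can be undone from the label it leaves behind, of which there are at most
    [r], then [A] is at most [r / k] times as large as [B]. *)
Lemma double_count (S C T D : finType) (A : {set S}) (B : {set T})
    (fw : S -> {set C}) (bw : T -> {set D}) (f : S * C -> T * D) (k r : nat) :
  (forall s, s \in A -> k <= #|fw s|) ->
  (forall t, t \in B -> #|bw t| <= r) ->
  (forall s c, s \in A -> c \in fw s ->
     (f (s, c)).1 \in B /\ (f (s, c)).2 \in bw (f (s, c)).1) ->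
  (forall s c s' c', s \in A -> c \in fw s -> s' \in A -> c' \in fw s' ->
     f (s, c) = f (s', c') -> (s, c) = (s', c')) ->
  #|A| * k <= #|B| * r.
Proof.
move=> leF leR fP finj.
pose pairs (U V : finType) (X : {set U}) (g : U -> {set V}) :=
  [set p : U * V | (p.1 \in X) && (p.2 \in g p.1)].
have cardE (U V : finType) (X : {set U}) (g : U -> {set V}) :
    #|pairs U V X g| = \sum_(u in X) #|g u|.
  rewrite -sum1_card; under [RHS]eq_bigr do rewrite -sum1_card.
  by rewrite pair_big_dep; apply: eq_bigl => p; rewrite inE.
have h1 : #|A| * k <= #|pairs S C A fw|.
  by rewrite cardE -sum_nat_const; apply: leq_sum => s /leF.
have h2 : #|pairs T D B bw| <= #|B| * r.
  by rewrite cardE -sum_nat_const; apply: leq_sum => s /leR.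
apply: leq_trans h1 (leq_trans _ h2).
rewrite -(@card_in_imset _ _ f) => [|[s c] [s' c']].
  apply/subset_leq_card/subsetP => _ /imsetP[[s c] + ->].
  by rewrite !inE /= => /andP[sA cF]; have [-> ->] := fP _ _ sA cF.
by rewrite !inE /= => /andP[? ?] /andP[? ?]; exact: finj.
Qed.

(** * Switchings *)

Section Graph.
Variable n : nat.
Implicit Types (G : sgraph n) (a b c e u v w x y p q : 'I_n).

Lemma adjC G u v : adj G u v = adj G v u.
Proof. by rewrite /adj finset.setUC. Qed.

Lemma adj_irr G u : adj G u u = false.
Proof.
apply/negP; rewrite /adj => h.
have := forallP (valP G) [set u; u]; rewrite h /= setUid cards1.
by [].
Qed.

Lemma adj_neq G u v : adj G u v -> u != v.
Proof. by apply: contraTneq => ->; rewrite adj_irr. Qed.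

Definition same_pair u v a b := (u == a) && (v == b) || (u == b) && (v == a).

Lemma eq_set2 u v a b : ([set u; v] == [set a; b]) = same_pair u v a b.
Proof.
apply/eqP/idP => [E|/orP[/andP[/eqP-> /eqP->] //|/andP[/eqP-> /eqP->]]].
  have : (u \in [set a; b]) && (v \in [set a; b]) by rewrite -E !inE !eqxx orbT.
  have : (a \in [set u; v]) && (b \in [set u; v]) by rewrite E !inE !eqxx orbT.
  rewrite !inE /same_pair !(eq_sym a) !(eq_sym b).
  by case: (u == a); case: (u == b); case: (v == a); case: (v == b).
by rewrite finset.setUC.
Qed.

(** Replaces the edges [ab] and [ce] by [ac] and [be], which preserves all
    degrees. *)
Definition sw_edges a b c e (E : {set {set 'I_n}}) :=
  [set a; c] |: ([set b; e] |: (E :\ [set a; b] :\ [set c; e])).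

(** Total thanks to [insubd]; meaningful under [switchable] below. *)
Definition switch a b c e G : sgraph n := insubd G (sw_edges a b c e (val G)).

Definition nbr G u := [set v | adj G u v].
Definition cnbr G u := u |: nbr G u.

(** Adjacency and the two closed neighbourhoods are enough to force [a], [b],
    [c], [e] to be distinct: [c] avoids [b], a neighbour of [a], and [e] avoids
    [a], a neighbour of [b]. *)
Definition switchable G a b c e :=
  [&& adj G a b, adj G c e, c \notin cnbr G a & e \notin cnbr G b].

Lemma switchable_neq G a b c e : switchable G a b c e ->
  [/\ a != b, a != c, a != e, b != c & b != e] /\
  [/\ c != e, ~~ adj G a c & ~~ adj G b e].
Proof.
rewrite /switchable !inE !negb_or.
move=> /and4P[ab ce /andP[ca Nac] /andP[eb Nbe]].
split; split=> //; rewrite ?(adj_neq ab) ?(adj_neq ce) //.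
- by rewrite eq_sym.
- by apply: contra Nbe => /eqP <-; rewrite adjC.
- by apply: contra Nac => /eqP <-.
- by rewrite eq_sym.
Qed.

Lemma adj_switch G a b c e u v : switchable G a b c e ->
  adj (switch a b c e G) u v =
  [|| same_pair u v a c, same_pair u v b e |
   [&& ~~ same_pair u v c e, ~~ same_pair u v a b & adj G u v]].
Proof.
move=> /switchable_neq[[_ ac _ _ be] _].
rewrite /adj /switch insubdK; first by rewrite !inE !eq_set2.
apply/forallP => s; apply/implyP; rewrite !inE.
case/or3P => [/eqP->|/eqP->|/and3P[_ _ sG]]; rewrite ?cards2 ?ac ?be //.
by have := forallP (valP G) s; rewrite sG.
Qed.

Lemma sgraph_inj G G' : adj G =2 adj G' -> G = G'.
Proof.
move=> E; apply: val_inj; apply/setP => s.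
case: (boolP (#|s| == 2)) => [/cards2P[x [y [_ ->]]]|s2]; first exact: (E x y).
have h (H : sgraph n) : s \in val H = false.
  by apply/negP => sH; have := forallP (valP H) s; rewrite sH /= (negPf s2).
by rewrite !h.
Qed.

Lemma switchable_switch G a b c e : switchable G a b c e ->
  switchable (switch a b c e G) a c b e.
Proof.
move=> ok; have [[ab ac ae bc be] [ce _ _]] := switchable_neq ok.
rewrite /switchable !inE !adj_switch // /same_pair !eqxx /=.
rewrite (negPf ac) (negPf be) (eq_sym c a) (eq_sym b a) (eq_sym e b) (eq_sym e c).
rewrite (eq_sym c b) (eq_sym e a) .
rewrite  (negPf ab) (negPf ac) (negPf ae) (negPf bc) (negPf be) (negPf ce) .
by [].
Qed.

Lemma switchK G a b c e : switchable G a b c e ->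
  switch a c b e (switch a b c e G) = G.
Proof.
move=> ok; have [[ab ac ae bc be] [ce nac nbe]] := switchable_neq ok.
apply: sgraph_inj => u v; rewrite adj_switch ?switchable_switch // adj_switch //.
have /and4P[Aab Ace _ _] := ok.
case: (boolP (same_pair u v a b)) => [/orP[]/andP[/eqP-> /eqP->]|_] /=.
- by rewrite Aab.
- by rewrite adjC Aab.
case: (boolP (same_pair u v c e)) => [/orP[]/andP[/eqP-> /eqP->]|_] /=.
- by rewrite Ace.
- by rewrite adjC Ace.
case: (boolP (same_pair u v b e)) => [/orP[]/andP[/eqP-> /eqP->]|_] /=.
- by rewrite (negPf nbe).
- by rewrite adjC (negPf nbe).
case: (boolP (same_pair u v a c)) => [/orP[]/andP[/eqP-> /eqP->]|_] //=.
- by rewrite (negPf nac).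
- by rewrite adjC (negPf nac).
Qed.

Lemma degreeE G u : degree G u = #|nbr G u|. Proof. by []. Qed.

Lemma degree_switch G a b c e u : switchable G a b c e ->
  degree (switch a b c e G) u = degree G u.
Proof.
move=> ok; have [[ab ac ae bc be] [ce nac nbe]] := switchable_neq ok.
have /and4P[Aab Ace _ _] := ok.
have move1 (A : {set 'I_n}) x y : x \in A -> y \notin A -> #|y |: (A :\ x)| = #|A|.
  by move=> xA yA; rewrite cardsU1 !inE (negPf yA) andbF (cardsD1 x A) xA.
have main x y z : y \in nbr G x -> z \notin nbr G x ->
    (forall v, adj (switch a b c e G) x v = (v == z) || (v != y) && adj G x v) ->
    degree (switch a b c e G) x = degree G x.
  move=> yN zN h; rewrite !degreeE -(move1 _ _ _ yN zN).
  by apply: eq_card => v; rewrite !inE h.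
have [ba ca ea cb eb] : [/\ b != a, c != a, e != a, c != b & e != b].
  by split; rewrite eq_sym.
have ec : e != c by rewrite eq_sym.
have neqs := (negPf ab, negPf ac, negPf ae, negPf bc, negPf be, negPf ce,
  negPf ba, negPf ca, negPf ea, negPf cb, negPf eb, negPf ec).
case: (eqVneq u a) => [->|ua].
  apply: (main a b c) => [||v]; last by rewrite adj_switch // /same_pair !eqxx !neqs /= ?orbF.
  by rewrite inE.
  by rewrite inE.
case: (eqVneq u b) => [->|ub].
  apply: (main b a e) => [||v]; last by rewrite adj_switch // /same_pair !eqxx !neqs /= ?orbF.
  by rewrite inE adjC.
  by rewrite inE.
case: (eqVneq u c) => [->|uc].
  apply: (main c e a) => [||v]; last by rewrite adj_switch // /same_pair !eqxx !neqs /= ?orbF.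
  by rewrite inE.
  by rewrite inE adjC.
case: (eqVneq u e) => [->|ue].
  apply: (main e c b) => [||v]; last by rewrite adj_switch // /same_pair !eqxx !neqs /= ?orbF.
  by rewrite inE adjC.
  by rewrite inE adjC.
rewrite !degreeE; apply: eq_card => v.
by rewrite !inE adj_switch // /same_pair (negPf ua) (negPf ub) (negPf uc) (negPf ue).
Qed.

Lemma regular_switch G a b c e d : switchable G a b c e ->
  regular (switch a b c e G) d = regular G d.
Proof. by move=> ok; apply: eq_forallb => x; rewrite degree_switch. Qed.

Lemma card_darts G d (A : {set 'I_n}) : regular G d ->
  #|[set pq : 'I_n * 'I_n | adj G pq.1 pq.2 && (pq.1 \in A)]| = d * #|A|.
Proof.
move=> /forallP regG.
transitivity (\sum_(p in A) degree G p).
  rewrite -sum1_card; under [RHS]eq_bigr do rewrite /degree -sum1_card.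
  by rewrite pair_big_dep; apply: eq_bigl => p; rewrite !inE andbC.
by rewrite (eq_bigr (fun _ => d)) ?sum_nat_const 1?mulnC // => p _; apply/eqP.
Qed.

Lemma card_darts_rev G d (A : {set 'I_n}) : regular G d ->
  #|[set pq : 'I_n * 'I_n | adj G pq.1 pq.2 && (pq.2 \in A)]| = d * #|A|.
Proof.
move=> regG; rewrite -(card_darts A regG).
have swapK : involutive (fun pq : 'I_n * 'I_n => (pq.2, pq.1)) by case.
rewrite -(card_imset _ (inv_inj swapK)).
apply: eq_card => -[p q]; rewrite !inE /=.
apply/imsetP/idP => [[[a b]]|h].
  by rewrite inE /= => h [-> ->]; rewrite adjC.
by exists (q, p); rewrite // inE /= adjC.
Qed.

Lemma card_cnbr G d u : regular G d -> #|cnbr G u| = d.+1.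
Proof.
by move=> /forallP/(_ u)/eqP h; rewrite /cnbr cardsU1 inE adj_irr -degreeE h.
Qed.

(** Almost all darts can be switched against the fixed edge [ab]: a dart
    [(c, e)] is excluded only if [c] lies in [A] or in the closed neighbourhood
    of [a], or [e] lies in [A] or in that of [b], and a vertex set [B] is the
    origin, and the end, of only [d * #|B|] darts. *)
Lemma card_switchable G d a b (A : {set 'I_n}) : regular G d -> adj G a b ->
  d * (n - (#|A| + d.+1).*2) <=
  #|[set pq : 'I_n * 'I_n | [&& switchable G a b pq.1 pq.2,
                                pq.1 \notin A & pq.2 \notin A]]|.
Proof.
move=> regG ab.
set V := [set _ | _].
pose D1 := [set pq : 'I_n * 'I_n | adj G pq.1 pq.2 && (pq.1 \in A :|: cnbr G a)].
pose D2 := [set pq : 'I_n * 'I_n | adj G pq.1 pq.2 && (pq.2 \in A :|: cnbr G b)].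
have cD u : #|A :|: cnbr G u| <= #|A| + d.+1.
  by rewrite -(card_cnbr u regG) cardsU leq_subr.
have c1 : #|D1| <= d * (#|A| + d.+1) by rewrite (card_darts _ regG) leq_mul2l cD orbT.
have c2 : #|D2| <= d * (#|A| + d.+1) by rewrite (card_darts_rev _ regG) leq_mul2l cD orbT.
have : #|[set pq : 'I_n * 'I_n | adj G pq.1 pq.2 && (pq.1 \in [set: 'I_n])]|
       <= #|V :|: (D1 :|: D2)|.
  apply/subset_leq_card/subsetP => -[p q]; rewrite in_set /= => /andP[pq _].
  rewrite /V /D1 /D2 /switchable; move: (cnbr G a) (cnbr G b) => X Y.
  rewrite !inE /= ab pq /=.
  by case: (p \in A); case: (q \in A); case: (p \in X); case: (q \in Y).
rewrite (card_darts _ regG) cardsT card_ord => h.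
have h2 : #|V :|: (D1 :|: D2)| <= #|V| + (#|D1| + #|D2|).
  by apply: leq_trans (leq_card_setU _ _) _; rewrite leq_add2l leq_card_setU.
rewrite mulnBr -muln2 mulnA leq_subLR muln2 -addnn.
by apply: leq_trans h (leq_trans h2 _); rewrite addnC leq_add2r leq_add.
Qed.

(** * Resampling a neighbourhood *)

Section Slots.
Variables (d : nat) (w : 'I_n).
Implicit Types (f : {ffun 'I_d -> 'I_n}) (i j : 'I_d).

(** [f] enumerates the neighbourhood of [w]. Carrying such an enumeration along
    with the graph lets the neighbours of [w] be resampled one at a time. *)
Definition slots G f := injectiveb f && [forall j, adj G w (f j)].

Definition reslot f i p : {ffun 'I_d -> 'I_n} :=
  [ffun j => if j == i then p else f j].

Definition slotted (P : sgraph n -> {ffun 'I_d -> 'I_n} -> bool) :=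
  [set s : sgraph n * {ffun 'I_d -> 'I_n} |
    [&& regular s.1 d, slots s.1 s.2 & P s.1 s.2]].

Lemma slots_switch G f i p q : slots G f -> switchable G w (f i) p q ->
  slots (switch w (f i) p q G) (reslot f i p).
Proof.
move=> /andP[/injectiveP finj /forallP fN] ok.
have [[wx wp wq xp xq] [pq Nwp Nxq]] := switchable_neq ok.
apply/andP; split.
  apply/injectiveP => j k; rewrite !ffunE.
  case: eqP => [->|_]; case: eqP => [->|_] // E.
  - by move: (fN k); rewrite -E (negPf Nwp).
  - by move: (fN j); rewrite E (negPf Nwp).
  - exact: finj.
apply/forallP => j; rewrite ffunE adj_switch // /same_pair !eqxx.
case: (eqVneq j i) => [_|ji]; first by rewrite eqxx.
have fji : f j != f i by apply: contra ji => /eqP/finj ->.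
by rewrite (negPf wx) (negPf wp) (negPf wq) (negPf fji) fN /= !orbT.
Qed.

(** Resampling the [i]-th neighbour [x] of [w]: a dart [(p, q)] is chosen and
    the edges [wx], [pq] become [wp], [xq]. The step is undone by the dart
    [(x, q)], so it is essentially measure preserving. Forbidding [p] and [q] to
    lie in [S] costs a proportion about [2 * #|S| / n] of the choices, while
    knowing that [x] was outside [Z] leaves only a proportion [1 - #|Z| / n] of
    the ways back. *)
Lemma slot_step i (P Q : sgraph n -> {ffun 'I_d -> 'I_n} -> bool)
    (S Z : {set 'I_n}) :
  (forall G f p q, regular G d -> slots G f -> P G f ->
     switchable G w (f i) p q -> p \notin S -> q \notin S ->
     f i \notin Z /\ Q (switch w (f i) p q G) (reslot f i p)) ->
  #|slotted P| * (n - (#|S| + d.+1).*2) <= #|slotted Q| * (n - #|Z|).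
Proof.
move=> PQ.
have d0 : 0 < d by apply: leq_ltn_trans (ltn_ord i).
rewrite -(leq_pmul2l d0) !(mulnCA d).
pose fw (s : sgraph n * {ffun 'I_d -> 'I_n}) :=
  [set pq : 'I_n * 'I_n | [&& switchable s.1 w (s.2 i) pq.1 pq.2,
                                pq.1 \notin S & pq.2 \notin S]].
pose bw (s : sgraph n * {ffun 'I_d -> 'I_n}) :=
  [set pq : 'I_n * 'I_n | adj s.1 pq.1 pq.2 && (pq.1 \in ~: Z)].
pose g (s : (sgraph n * {ffun 'I_d -> 'I_n}) * ('I_n * 'I_n)) :=
  ((switch w (s.1.2 i) s.2.1 s.2.2 s.1.1, reslot s.1.2 i s.2.1),
   (s.1.2 i, s.2.2)).
apply: (@double_count _ _ _ _ _ _ fw bw g).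
- move=> [G f]; rewrite inE => /and3P[regG /andP[_ /forallP fN] _].
  by rewrite card_switchable //; exact: fN.
- move=> [G f]; rewrite inE => /and3P[regG _ _].
  by rewrite (card_darts _ regG) cardsCs finset.setCK card_ord.
- move=> [G f] [p q]; rewrite !inE /= => /and3P[regG sl PG] /and3P[ok pS qS].
  have [fZ QG] := PQ G f p q regG sl PG ok pS qS.
  rewrite QG fZ regular_switch // regG slots_switch //=.
  by have /and4P[_ -> _ _] := switchable_switch ok.
- suff gK s (c : 'I_n * 'I_n) : s \in slotted P -> c \in fw s -> g (g (s, c)) = (s, c).
    by move=> s c s' c' sA cF sA' cF' E; rewrite -(gK s c) // -(gK s' c') // E.
  case: s c => G f [p q]; rewrite !inE /= => _ /and3P[ok _ _].
  rewrite /g /= !ffunE eqxx switchK //; congr (_, _, _).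
  by apply/ffunP => j; rewrite !ffunE; case: eqP => // ->.
Qed.

Lemma slot_steps (P : nat -> sgraph n -> {ffun 'I_d -> 'I_n} -> bool)
    (S Z : {set 'I_n}) :
  (forall i G f p q, regular G d -> slots G f -> P i G f ->
     switchable G w (f i) p q -> p \notin S -> q \notin S ->
     f i \notin Z /\ P i.+1 (switch w (f i) p q G) (reslot f i p)) ->
  #|slotted (P 0)| * (n - (#|S| + d.+1).*2) ^ d <=
  #|slotted (P d)| * (n - #|Z|) ^ d.
Proof.
move=> PP.
suff h k : k <= d -> #|slotted (P 0)| * (n - (#|S| + d.+1).*2) ^ k <=
  #|slotted (P k)| * (n - #|Z|) ^ k by exact: h.
elim: k => [|k IH] kd; first by rewrite !expn0.
have := slot_step (i := Ordinal kd) (PP (Ordinal kd)); have := IH (ltnW kd).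
rewrite !expnS; move: (_ ^ k) (_ ^ k) => X Y h1 h2.
rewrite [X in X <= _]mulnCA [X in _ <= X]mulnA mulnC.
apply: leq_trans (leq_mul h1 (leqnn _)) _.
by rewrite mulnAC leq_mul.
Qed.

(** Each regular graph carries exactly [d`!] enumerations of the neighbourhood
    of [w], so ratios are the same with and without enumerations. *)
Lemma card_slotted (P : pred (sgraph n)) :
  #|slotted (fun G _ => P G)| = #|[set G : sgraph n | regular G d && P G]| * d`!.
Proof.
transitivity (\sum_(G | regular G d && P G) #|[set f | slots G f]|).
  rewrite -sum1_card; under [RHS]eq_bigr do rewrite -sum1_card.
  rewrite pair_big_dep; apply: eq_bigl => -[G f].
  by rewrite !inE /= andbAC andbA.
rewrite (eq_bigr (fun _ => d`!)).
  by rewrite sum_nat_const; congr (_ * _); apply: eq_card => G; rewrite inE.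
move=> G /andP[/forallP/(_ w)/eqP dG _].
rewrite -ffactnn -[in X in X ^_ _]dG -[in RHS](card_ord d) -card_inj_ffuns_on.
apply: eq_card => f; rewrite !inE andbC; congr (_ && _).
by apply/forallP/ffun_onP => h j; have := h j; rewrite inE.
Qed.

Lemma slots_onto G f v : regular G d -> slots G f -> adj G w v ->
  exists j, v = f j.
Proof.
move=> /forallP/(_ w)/eqP dG /andP[/injectiveP finj /forallP fN] wv.
have : f @: 'I_d == nbr G w.
  rewrite eqEcard card_imset // card_ord -degreeE dG leqnn andbT.
  by apply/subsetP => _ /imsetP[j _ ->]; rewrite inE.
move=> /eqP E; have : v \in f @: 'I_d by rewrite E inE.
by case/imsetP => j _ ->; exists j.
Qed.

End Slots.

(** * Counting graphs with given pairs of sets *)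

Definition count_regular d (P : pred (sgraph n)) :=
  #|[set G : sgraph n | regular G d && P G]|.

Lemma count_regular_le d (P Q : pred (sgraph n)) :
  (forall G, regular G d -> P G -> Q G) -> count_regular d P <= count_regular d Q.
Proof.
move=> PQ; apply/subset_leq_card/subsetP => G; rewrite !inE => /andP[rG PG].
by rewrite rG PQ.
Qed.

Definition separated (X Y : {set 'I_n}) G := [forall x in X, forall y in Y, ~~ adj G x y].
Definition dominates (S W : {set 'I_n}) G := [forall v in W, exists u in S, adj G u v].

Lemma separatedP (X Y : {set 'I_n}) G :
  reflect (forall x y, x \in X -> y \in Y -> ~~ adj G x y) (separated X Y G).
Proof.
apply: (iffP forall_inP) => [h x y xX|h x xX]; first by move/forall_inP: (h x xX); exact.
by apply/forall_inP => y; exact: h.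
Qed.

Lemma dominatesP (S W : {set 'I_n}) G :
  reflect (forall v, v \in W -> exists2 u, u \in S & adj G u v) (dominates S W G).
Proof. by apply: (iffP forall_inP) => h v /h /exists_inP. Qed.

(** Given that [X] is independent with no edges to [Y], the vertex [w] misses
    [X :|: Y] with probability about [(1 - #|X :|: Y| / n) ^ d], as if its [d]
    neighbours were uniform and independent. Starting from a graph where [w]
    misses [Z], the neighbours of [w] are resampled without restriction. None of
    the new edges [wp], [xq] lies inside [Z], because [w] and the discarded
    neighbour [x] are outside [Z]; so the event on [X] survives, and each of the
    [d] steps loses a factor [1 - #|Z| / n] on the way back. *)
Lemma isolated_step d (X Y : {set 'I_n}) w : w \notin X :|: Y ->
  count_regular d (separated (w |: X) ((w |: X) :|: Y)) * (n - d.+1.*2) ^ d <=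
  count_regular d (separated X (X :|: Y)) * (n - #|Y|) ^ d.
Proof.
move=> wXY; set Z := X :|: Y.
pose P i G (f : {ffun 'I_d -> 'I_n}) :=
  separated X Z G && [forall j : 'I_d, (i <= j) ==> (f j \notin Z)].
have := @slot_steps d w P set0 Z; rewrite cards0 add0n => step.
have {}step : #|slotted w (P 0)| * (n - d.+1.*2) ^ d <= #|slotted w (P d)| * (n - #|Z|) ^ d.
  apply: step => i G f p q regG sl /andP[sep /forallP fZ] ok _ _.
  have fi : f i \notin Z by have := fZ i; rewrite leqnn.
  split=> //; apply/andP; split; last first.
    apply/forallP => j; apply/implyP => ij; rewrite ffunE.
    have /negPf -> : j != i by rewrite -val_eqE neq_ltn ij orbT.
    by have := fZ j; rewrite (ltnW ij).
  have XZ x : x \in X -> x \in Z by rewrite /Z inE => ->.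
  have ne a b : a \notin Z -> b \in Z -> (b == a) = false.
    by move=> aZ bZ; apply/negP => /eqP E; rewrite -E bZ in aZ.
  apply/separatedP => x y xX yZ; rewrite adj_switch // /same_pair.
  have xZ := XZ x xX.
  rewrite (ne w x) // (ne w y) // (ne (f i) x) // (ne (f i) y) // !andbF /=.
  by rewrite (negPf (separatedP _ _ _ sep x y xX yZ)) andbF.
have le0 : #|slotted w (fun G (_ : {ffun 'I_d -> 'I_n}) =>
    separated (w |: X) ((w |: X) :|: Y) G)| <= #|slotted w (P 0)|.
  apply/subset_leq_card/subsetP => -[G f]; rewrite !inE /= => /and3P[-> sl /separatedP sep].
  rewrite sl /= /P; apply/andP; split.
    by apply/separatedP => x y xX yZ; apply: sep; rewrite !inE ?xX ?orbT // -orbA orbC;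
      move: yZ; rewrite inE => ->.
  apply/forallP => j /=; move: sl => /andP[_ /forallP/(_ j)]; apply: contraL => fZ.
  apply: sep; rewrite !inE ?eqxx // -orbA; apply/orP; right.
  by move: fZ; rewrite inE.
have le1 : #|slotted w (P d)| <=
    #|slotted w (fun G (_ : {ffun 'I_d -> 'I_n}) => separated X Z G)|.
  apply/subset_leq_card/subsetP => -[G f]; rewrite !inE /= => /and3P[-> ->].
  by case/andP.
rewrite !card_slotted in le0 le1.
rewrite -(leq_pmul2r (fact_gt0 d)) mulnAC [X in _ <= X]mulnAC.
apply: leq_trans (leq_mul le0 (leqnn _)) (leq_trans step _).
apply: leq_mul le1 _; have [->|d0] := posnP d; first by rewrite !expn0.
by rewrite leq_exp2r // leq_sub2l // subset_leq_card // subsetUr.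
Qed.

Lemma count_isolated d (X Y : {set 'I_n}) : [disjoint X & Y] ->
  count_regular d (separated X (X :|: Y)) * (n - d.+1.*2) ^ (d * #|X|) <=
  count_regular d predT * (n - #|Y|) ^ (d * #|X|).
Proof.
elim: {X}#|X| {-2}X (erefl #|X|) => [|k IH] X cX dXY.
  by rewrite cX muln0 !expn0 !muln1 count_regular_le.
have /card_gt0P[w wX] : 0 < #|X| by rewrite cX.
have cX' : #|X :\ w| = k by move: cX; rewrite (cardsD1 w X) wX => -[].
have dX' : [disjoint X :\ w & Y] by apply: disjointWl dXY; exact: subsetDl.
have wn : w \notin (X :\ w) :|: Y by rewrite !inE eqxx /= (disjointFr dXY).
have := isolated_step d wn; rewrite setD1K // => h1.
have h2 := IH _ cX' dX'.
rewrite cX -cX' mulnS !expnD mulnA.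
apply: leq_trans (leq_mul h1 (leqnn _)) _.
by rewrite mulnAC [X in _ <= X]mulnCA [X in _ <= X]mulnC leq_mul.
Qed.

(** Given that [S] dominates [W], a further vertex [w] stays undominated with
    probability at least about [(1 - 2 * #|S| / n) ^ d]: resample all
    neighbours of [w] using darts [(p, q)] with both ends outside [S]. Such
    switches remove no edge between [S] and [W], and at the end no neighbour of
    [w] is in [S]. *)
Lemma dominates_step d (S W : {set 'I_n}) w : [disjoint S & w |: W] -> w \notin W ->
  count_regular d (dominates S (w |: W)) * n ^ d +
  count_regular d (dominates S W) * (n - (#|S| + d.+1).*2) ^ d <=
  count_regular d (dominates S W) * n ^ d.
Proof.
move=> dSW wW; have wS : w \notin S.
  by rewrite (disjointFl dSW) // !inE eqxx.
pose P i G (f : {ffun 'I_d -> 'I_n}) :=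
  dominates S W G && [forall j : 'I_d, (j < i) ==> (f j \notin S)].
have := @slot_steps d w P S set0; rewrite cards0 subn0 => step.
have {}step : #|slotted w (P 0)| * (n - (#|S| + d.+1).*2) ^ d <= #|slotted w (P d)| * n ^ d.
  apply: step => i G f p q regG sl /andP[/dominatesP dom /forallP fS] ok pS qS.
  split; first by rewrite inE.
  apply/andP; split; last first.
    apply/forallP => j; apply/implyP; rewrite ffunE ltnS leq_eqVlt val_eqE.
    by case: (eqVneq j i) => [//|_] /= ji; have := fS j; rewrite ji.
  apply/dominatesP => v vW; have [u uS uv] := dom v vW; exists u => //.
  have vw : (v == w) = false by apply: contraNF wW => /eqP <-.
  have uw : (u == w) = false by apply: contraNF wS => /eqP <-.
  have up : (u == p) = false by apply: contraNF pS => /eqP <-.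
  have uq : (u == q) = false by apply: contraNF qS => /eqP <-.
  by rewrite adj_switch // /same_pair uw up uq vw uv /= !andbF !orbT.
have le0 : #|slotted w (fun G (_ : {ffun 'I_d -> 'I_n}) => dominates S W G)| <=
    #|slotted w (P 0)|.
  apply/subset_leq_card/subsetP => -[G f]; rewrite !inE /= => /and3P[-> -> dom].
  by rewrite /P dom; apply/forallP.
have le1 : #|slotted w (P d)| <= #|slotted w (fun G (_ : {ffun 'I_d -> 'I_n}) =>
    dominates S W G && ~~ dominates S (w |: W) G)|.
  apply/subset_leq_card/subsetP => -[G f]; rewrite !inE /=.
  move=> /and3P[rG sl /andP[-> /forallP fS]]; rewrite rG sl /=.
  apply/negP => /dominatesP/(_ w)[|u uS uw]; first by rewrite !inE eqxx.
  rewrite adjC in uw; have [j uj] := slots_onto rG sl uw.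
  by have := fS j; rewrite ltn_ord -uj uS.
rewrite !card_slotted in le0 le1.
have split_dom : count_regular d (dominates S W) =
    count_regular d (dominates S (w |: W)) +
    count_regular d (fun G => dominates S W G && ~~ dominates S (w |: W) G).
  rewrite /count_regular -(cardsID [set G | dominates S (w |: W) G]).
  congr (_ + _); apply: eq_card => G; rewrite !inE.
    case: (regular G d) => //=; case: (boolP (dominates S (w |: W) G)) => [|_]; last by rewrite andbF.
    move=> /dominatesP dom; rewrite andbT; apply/dominatesP => v vW.
    by apply: dom; rewrite !inE vW orbT.
  by rewrite andbC andbA.
rewrite [X in _ <= X * _]split_dom mulnDl leq_add2l.
rewrite -(leq_pmul2r (fact_gt0 d)) mulnAC [X in _ <= X]mulnAC.
by apply: leq_trans (leq_mul le0 (leqnn _)) (leq_trans step _); rewrite leq_mul.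
Qed.

Lemma count_dominates d (S W : {set 'I_n}) : [disjoint S & W] ->
  count_regular d (dominates S W) * (n ^ d) ^ #|W| <=
  count_regular d predT * (n ^ d - (n - (#|S| + d.+1).*2) ^ d) ^ #|W|.
Proof.
elim: {W}#|W| {-2}W (erefl #|W|) => [|k IH] W cW dSW.
  by rewrite cW !expn0 !muln1 count_regular_le.
have /card_gt0P[w wW] : 0 < #|W| by rewrite cW.
have cW' : #|W :\ w| = k by move: cW; rewrite (cardsD1 w W) wW => -[].
have dW' : [disjoint S & W :\ w] by apply: disjointWr dSW; exact: subsetDl.
have := @dominates_step d S (W :\ w) w; rewrite setD1K // !inE eqxx => /(_ dSW isT) h1.
have h2 := IH _ cW' dW'.
have {}h1 : count_regular d (dominates S W) * n ^ d <=
    count_regular d (dominates S (W :\ w)) * (n ^ d - (n - (#|S| + d.+1).*2) ^ d).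
  by rewrite mulnBr leq_subRL ?(leq_trans _ h1) ?leq_addl // addnC.
rewrite cW -cW' !expnS mulnA; apply: leq_trans (leq_mul h1 (leqnn _)) _.
by rewrite mulnAC [X in _ <= X]mulnCA [X in _ <= X]mulnC leq_mul.
Qed.

(** Given that there are no edges between [X] and [Y], it is unlikely that [w]
    has no neighbour in [Y] either. A direct switch of an edge [wx] against a
    dart [(p, q)] with [p] in [Y] would create the edge [xq], possibly between
    [X] and [Y]. So [pq] is first switched against a dart [(u, t)] avoiding
    [Z = X' :|: Y], which gives [p] a neighbour [u] outside [Z], and then [wx]
    is switched against [pu]. The result has exactly one edge from [w] to [Y],
    and the number of choices gains a factor about [d * #|Y| / n]. *)
Lemma separated_step d (X Y : {set 'I_n}) w : [disjoint w |: X & Y] -> w \notin X ->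
  count_regular d (separated (w |: X) Y) *
    (d * #|Y| * (n - (#|X| + #|Y| + d.+2.*2).*2)) <=
  count_regular d (separated X Y) * n ^ 2.
Proof.
move=> dXY wX; set X' := w |: X; set Z := X' :|: Y.
have [->|d0] := posnP d; first by rewrite mul0n muln0.
have wX' : w \in X' by rewrite !inE eqxx.
have wZ : w \in Z by rewrite inE wX'.
have YZ y : y \in Y -> y \in Z by rewrite inE => ->; rewrite orbT.
have nXY x y : x \in X' -> y \in Y -> (x == y) = false.
  by move=> xX; apply: contraTF => /eqP <-; rewrite (disjointFr dXY).
have nZ z t : z \in Z -> t \notin Z -> (z == t) = false.
  by move=> zZ; apply: contraNF => /eqP <-.
pose T := (sgraph n * ('I_n * ('I_n * 'I_n)))%type.
pose A := [set G : sgraph n | regular G d && separated X' Y G].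
pose B := [set G : sgraph n | regular G d && separated X Y G].
(* [K0] marks a neighbour [x] of [w] and a dart [(p, q)] out of [Y]; in [K1] the
   dart has been redirected to leave [Z], and its end avoids [x] and the
   neighbours of [x], which the second switch requires. *)
pose K0 := [set s : T | [&& s.1 \in A, adj s.1 w s.2.1, adj s.1 s.2.2.1 s.2.2.2
                          & s.2.2.1 \in Y]].
pose K1 := [set s : T | [&& s.1 \in A, adj s.1 w s.2.1, adj s.1 s.2.2.1 s.2.2.2,
                          s.2.2.1 \in Y, s.2.2.2 \notin Z & s.2.2.2 \notin cnbr s.1 s.2.1]].
have step0 : #|A| * (d * (d * #|Y|)) <= #|K0| * 1.
  apply: (@double_count _ _ _ _ _ _ (fun G => setX (nbr G w)
      [set pq : 'I_n * 'I_n | adj G pq.1 pq.2 && (pq.1 \in Y)])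
      (fun _ => [set: unit]) (fun s => (s, tt))).
  - move=> G; rewrite inE => /andP[rG _].
    rewrite cardsX (card_darts _ rG) -degreeE.
    by have /eqP -> := forallP rG w.
  - by move=> t _; rewrite cardsT card_unit.
  - by move=> G [x [p q]] GA; rewrite !inE /= in GA *; rewrite GA.
  - by move=> G c G' c' _ _ _ _ [-> ->].
have step1 : #|K0| * (d * (n - (#|X| + #|Y| + d.+2.*2).*2)) <= #|K1| * (d * n).
  apply: (@double_count _ _ _ _ _ _ (fun s : T =>
      [set st : 'I_n * 'I_n | [&& switchable s.1 s.2.2.1 s.2.2.2 st.1 st.2,
        st.1 \notin Z :|: cnbr s.1 s.2.1 & st.2 \notin Z :|: cnbr s.1 s.2.1]])
      (fun s => [set st : 'I_n * 'I_n | adj s.1 st.1 st.2 && (st.1 \in [set: 'I_n])])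
      (fun s : T * ('I_n * 'I_n) => let: ((G, (x, (p, q))), (u, t)) := s in
         ((switch p q u t G, (x, (p, u))), (q, t)))).
  - move=> [G [x [p q]]]; rewrite !inE /= => /and4P[/andP[rG _] _ pq _].
    apply: leq_trans (card_switchable _ rG pq).
    rewrite leq_mul2l leq_sub2l ?orbT // leq_double.
    have h1 : #|Z :|: cnbr G x| <= #|Z| + d.+1.
      by rewrite -(card_cnbr x rG) leq_card_setU.
    have h2 : #|Z| <= #|X'| + #|Y| by exact: leq_card_setU.
    have h3 : #|X'| <= #|X|.+1 by rewrite cardsU1; case: (_ \notin _).
    move: h1 h2 h3; move: #|_ :|: _| #|Z| #|X'| #|X| #|Y|; lia.
  - move=> [G s]; rewrite !inE /= => /andP[/andP[rG _] _].
    by rewrite (card_darts _ rG) cardsT card_ord.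
  - move=> [G [x [p q]]] [u t]; rewrite [_ \in K0]inE => /and4P[/= GA wx pq pY].
    rewrite [(u, t) \in _]inE /= => /and3P[ok].
    rewrite in_setU negb_or => /andP[uZ ux]; rewrite in_setU negb_or => /andP[tZ tx].
    move: GA; rewrite inE => /andP[rG sep].
    have rG' : regular (switch p q u t G) d by rewrite regular_switch.
    have wp : (w == p) = false by exact: nXY.
    have wu : (w == u) = false by exact: nZ.
    have wt : (w == t) = false by exact: nZ.
    have xp : (x == p) = false.
      by apply: contraTF wx => /eqP ->; apply: (separatedP _ _ _ sep).
    move: (ux) (tx); rewrite !in_setU1 !negb_or => /andP[ux1 ux2] /andP[tx1 tx2].
    have {}ux2 : ~~ adj G x u by rewrite inE in ux2.
    have sep' : separated X' Y (switch p q u t G).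
      apply/separatedP => a b aX bY; rewrite adj_switch // /same_pair.
      have aZ : a \in Z by rewrite inE aX.
      rewrite (nXY a p) // (nZ a u) // (nZ a t) // (nZ b t) ?(YZ b) //.
      by rewrite (negPf (separatedP _ _ _ sep a b aX bY)) !andbF.
    have [[_ pu _ qu _] [ut _ _]] := switchable_neq ok.
    have /and4P[pu' qt' _ _] := switchable_switch ok.
    split; last by rewrite inE /= in_setT qt'.
    have GA' : switch p q u t G \in A by rewrite inE rG' sep'.
    rewrite inE /= GA' pu' pY uZ /=.
    apply/andP; split.
      by rewrite adj_switch // /same_pair wp wu wt wx /= xp !andbF orbT.
    rewrite in_setU1 negb_or ux1 inE adj_switch // /same_pair.
    rewrite xp (eq_sym u p) (negPf pu) (eq_sym x t) (negPf tx1).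
    by rewrite (eq_sym u q) (negPf qu) (negPf ut) (negPf ux2) /= !andbF.
  - move=> [G [x [p q]]] [u t] [G' [x' [p' q']]] [u' t'].
    rewrite ![in _ \in [set _ | _]]inE /=.
    move=> _ /and3P[ok _ _] _ /and3P[ok' _ _] E.
    case: E ok' => EG *; subst x' p' q' u' t'.
    by rewrite -(switchK ok) EG switchK //; exact: ok'.
have step2 : #|K1| * 1 <= #|B| * (d * n).
  apply: (@double_count _ _ _ _ _ _ (fun s : T => [set: unit])
      (fun G => [set st : 'I_n * 'I_n | adj G st.1 st.2 && (st.1 \in [set: 'I_n])])
      (fun s : T * unit => let: (G, (x, (p, u))) := s.1 in
         (switch w x p u G, (x, u)))).
  - by move=> s _; rewrite cardsT card_unit.
  - move=> G; rewrite inE => /andP[rG _].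
    by rewrite (card_darts _ rG) cardsT card_ord.
  - move=> [G [x [p u]]] []; rewrite [_ \in K1]inE => + _; move=> /and5P[/= GA wx pu pY /andP[uZ ux]].
    move: GA; rewrite inE => /andP[rG sep].
    have wp : ~~ adj G w p by exact: (separatedP _ _ _ sep).
    have xp : x != p by apply: contraNneq wp => <-.
    move: ux; rewrite in_setU1 negb_or inE => /andP[ux xu].
    have ok : switchable G w x p u.
      rewrite /switchable wx pu !inE !negb_or wp ux xu !andbT.
      by rewrite eq_sym nXY.
    have /and4P[_ xu' _ _] := switchable_switch ok.
    split; last by rewrite inE /= in_setT xu'.
    rewrite inE regular_switch // rG; apply/separatedP => a b aX bY.
    have aX' : a \in X' by rewrite inE aX orbT.
    have aZ : a \in Z by rewrite inE aX'.
    rewrite adj_switch // /same_pair (nXY a p) // (nZ a u) // (nZ b u) ?(YZ b) //.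
    rewrite (eq_sym b w) (nXY w b) // !andbF.
    have -> : (a == w) = false by apply: contraNF wX => /eqP <-.
    by rewrite (negPf (separatedP _ _ _ sep a b aX' bY)) !andbF.
  - move=> [G [x [p u]]] [] [G' [x' [p' u']]] [].
    rewrite ![_ \in K1]inE /=.
    move=> /and5P[/= GA wx pu pY /andP[uZ ux]] _ /and5P[/= GA' wx' pu' pY' /andP[uZ' ux']] _ E.
    case: E => EG *; subst x' u'.
    move: GA GA'; rewrite !inE => /andP[rG sep] /andP[rG' sep'].
    have wp : ~~ adj G w p by exact: (separatedP _ _ _ sep).
    have wp' : ~~ adj G' w p' by exact: (separatedP _ _ _ sep').
    move: ux ux'; rewrite !in_setU1 !negb_or !inE => /andP[ux xu] /andP[_ xu'].
    have ok : switchable G w x p u.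
      rewrite /switchable wx pu !inE !negb_or wp ux xu !andbT.
      by rewrite eq_sym nXY.
    have ok' : switchable G' w x p' u.
      rewrite /switchable wx' pu' !inE !negb_or wp' ux xu' !andbT.
      by rewrite eq_sym nXY.
    (* p is the only neighbour of w in Y after the switch *)
    have /and4P[wp2 _ _ _] := switchable_switch ok'.
    suff E : p' = p by subst p'; rewrite -(switchK ok) EG switchK.
    move: wp2; rewrite -EG adj_switch // /same_pair eqxx (eq_sym p' w) (nXY w p') //.
    rewrite (nZ w u) // (eq_sym p' x).
    have -> : (x == p') = false by apply: contraNF wp' => /eqP <-.
    have -> : (w == x) = false by rewrite (negPf (adj_neq wx)).
    rewrite (negPf (separatedP _ _ _ sep w p' wX' pY')) !andbF !orbF.
    by rewrite /= => /eqP.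
have : #|A| * (d * #|Y| * (n - (#|X| + #|Y| + d.+2.*2).*2)) * (d * d) <= #|B| * n ^ 2 * (d * d).
  move: (n - _) step1 => m step1.
  rewrite !muln1 in step0 step2.
  have := leq_mul step0 (leqnn (d * m)); move=> /leq_trans/(_ step1).
  move=> /leq_trans/(_ (leq_mul step2 (leqnn (d * n)))).
  by congr (is_true (_ <= _)); rewrite ?expnS; move: #|A| #|B| #|Y| => a b y; lia.
by rewrite leq_pmul2r // muln_gt0 d0.
Qed.

Lemma count_separated d (X Y : {set 'I_n}) m : [disjoint X & Y] ->
  #|X| + #|Y| + d.+2.*2 <= m ->
  count_regular d (separated X Y) * (d * #|Y| * (n - m.*2)) ^ #|X| <=
  count_regular d predT * (n ^ 2) ^ #|X|.
Proof.
elim: {X}#|X| {-2}X (erefl #|X|) => [|k IH] X cX dXY Xm.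
  by rewrite cX !expn0 !muln1 count_regular_le.
have /card_gt0P[w wX] : 0 < #|X| by rewrite cX.
have cX' : #|X :\ w| = k by move: cX; rewrite (cardsD1 w X) wX => -[].
have dX' : [disjoint X :\ w & Y] by apply: disjointWl dXY; exact: subsetDl.
have Xm' : #|X :\ w| + #|Y| + d.+2.*2 <= m by move: Xm; rewrite cX cX'; lia.
have := @separated_step d (X :\ w) Y w; rewrite setD1K // !inE eqxx => /(_ dXY isT) h1.
have {}h1 : count_regular d (separated X Y) * (d * #|Y| * (n - m.*2)) <=
    count_regular d (separated (X :\ w) Y) * n ^ 2.
  by apply: leq_trans h1; rewrite leq_mul // leq_mul // leq_sub2l // leq_double.
have h2 := IH _ cX' dX' Xm'.
rewrite cX -cX' !(expnS _ #|_|) mulnA; apply: leq_trans (leq_mul h1 (leqnn _)) _.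
by rewrite mulnAC [X in _ <= X]mulnCA [X in _ <= X]mulnC leq_mul.
Qed.

(** The union bound over pairs of vertex sets of prescribed sizes. *)
Lemma count_union d (D : pred ({set 'I_n} * {set 'I_n}))
    (P : {set 'I_n} * {set 'I_n} -> pred (sgraph n)) (a b F M : nat) :
  (forall p : {set 'I_n} * {set 'I_n}, D p -> [/\ #|p.1| = a, #|p.2| = b & count_regular d (P p) * F <= M]) ->
  count_regular d (fun G => [exists p : {set 'I_n} * {set 'I_n}, D p && P p G]) * F <= 'C(n, a) * 'C(n, b) * M.
Proof.
move=> DP.
have h1 : count_regular d (fun G => [exists p : {set 'I_n} * {set 'I_n}, D p && P p G]) <=
    \sum_(p | D p) count_regular d (P p).
  rewrite /count_regular.
  have -> : [set G | regular G d & [exists p : {set 'I_n} * {set 'I_n}, D p && P p G]] =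
      \bigcup_(p | D p) [set G | regular G d && P p G].
    apply/setP => G; rewrite inE; apply/andP/bigcupP.
      by case=> rG /existsP[p /andP[Dp Pp]]; exists p; rewrite // inE rG.
    by case=> p Dp; rewrite inE => /andP[-> Pp]; split=> //; apply/existsP; exists p; rewrite Dp.
  elim/big_rec2: _ => [|p k S _ IH]; first by rewrite cards0.
  by apply: leq_trans (leq_card_setU _ _) _; rewrite leq_add2l.
apply: leq_trans (leq_mul h1 (leqnn _)) _; rewrite big_distrl /=.
apply: leq_trans (_ : \sum_(p | D p) M <= _).
  by apply: leq_sum => p /DP[].
rewrite sum_nat_const leq_mul2r; apply/orP; right.
have <- : #|setX [set X : {set 'I_n} | #|X| == a] [set X : {set 'I_n} | #|X| == b]| =
    'C(n, a) * 'C(n, b) by rewrite cardsX !card_draws card_ord.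
apply/subset_leq_card/subsetP => p /DP[ca cb _].
by case: p ca cb => X Y /= ca cb; rewrite !inE /= ca cb !eqxx.
Qed.

Definition bad_isolated (a b : nat) G :=
  [exists p : {set 'I_n} * {set 'I_n},
    [&& [disjoint p.1 & p.2], #|p.1| == a & #|p.2| == b] &&
    separated p.1 (p.1 :|: p.2) G].
Definition bad_separated (a b : nat) G :=
  [exists p : {set 'I_n} * {set 'I_n},
    [&& [disjoint p.1 & p.2], #|p.1| == a & #|p.2| == b] && separated p.1 p.2 G].
(** [S] of size [s] dominates everything outside itself, up to [t] vertices. *)
Definition bad_dominating s t G :=
  [exists p : {set 'I_n} * {set 'I_n},
    [&& [disjoint p.1 & p.2], #|p.1| == s & #|p.2| == t] &&
    dominates p.1 (~: (p.1 :|: p.2)) G].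

Lemma count_bad_isolated d (a b : nat) :
  count_regular d (bad_isolated a b) * (n - d.+1.*2) ^ (d * a) <=
  'C(n, a) * 'C(n, b) * (count_regular d predT * (n - b) ^ (d * a)).
Proof.
apply: count_union => -[X Y] /= /and3P[dXY /eqP <- /eqP <-]; split=> //.
exact: count_isolated.
Qed.

Lemma count_bad_separated d (a b m : nat) : a + b + d.+2.*2 <= m ->
  count_regular d (bad_separated a b) * (d * b * (n - m.*2)) ^ a <=
  'C(n, a) * 'C(n, b) * (count_regular d predT * (n ^ 2) ^ a).
Proof.
move=> abm; apply: count_union => -[X Y] /= /and3P[dXY /eqP ca /eqP cb]; split=> //.
by rewrite -ca -cb; apply: count_separated; rewrite // ca cb.
Qed.

Lemma count_bad_dominating d s t :
  count_regular d (bad_dominating s t) * (n ^ d) ^ (n - (s + t)) <=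
  'C(n, s) * 'C(n, t) * (count_regular d predT *
     (n ^ d - (n - (s + d.+1).*2) ^ d) ^ (n - (s + t))).
Proof.
apply: count_union => -[S T] /= /and3P[dST /eqP cs /eqP ct]; split=> //.
have -> : n - (s + t) = #|~: (S :|: T)|.
  have := cardsC (S :|: T); rewrite cardsU cs ct.
  by rewrite (disjoint_setI0 dST) cards0 card_ord subn0; lia.
rewrite -cs; apply: count_dominates.
by rewrite disjoints_subset finset.setCK subsetUl.
Qed.

(** * Induced paths by depth first search *)

Definition undominated (S : {set 'I_n}) G :=
  [set v | (v \notin S) && [forall u in S, ~~ adj G u v]].

Lemma undominatedS (S S' : {set 'I_n}) G : S \subset S' ->
  undominated S' G \subset undominated S G.
Proof.
move=> /subsetP SS; apply/subsetP => v; rewrite !inE => /andP[vS /forall_inP h].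
apply/andP; split; first by apply: contra vS => /SS.
by apply/forall_inP => u /SS/h.
Qed.

Lemma subset_of_card (T : finType) (A : {set T}) k : k <= #|A| ->
  exists2 B : {set T}, B \subset A & #|B| = k.
Proof.
move=> kA; exists [set x in take k (enum A)].
  by apply/subsetP => x; rewrite inE => /mem_take; rewrite mem_enum.
rewrite cardsE; have /card_uniqP -> : uniq (take k (enum A)) by rewrite take_uniq ?enum_uniq.
by rewrite size_take -cardE; case: ltngtP kA.
Qed.

Lemma superset_of_card (T : finType) (A : {set T}) k : #|A| <= k -> k <= #|T| ->
  exists2 B : {set T}, A \subset B & #|B| = k.
Proof.
move=> Ak kT; have [|C CA cC] := @subset_of_card T (~: A) (k - #|A|).
  by rewrite [#|~: A|]cardsCs finset.setCK leq_sub2r.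
exists (A :|: C); first exact: subsetUl.
have /eqP dAC : A :&: C == set0.
  by rewrite setI_eq0 disjoint_sym disjoints_subset.
by rewrite cardsU dAC cards0 subn0 cC subnKC.
Qed.

Lemma card_undominated s t G (S : {set 'I_n}) :
  ~~ bad_dominating s t G -> s + t <= n -> #|S| <= s -> t < #|undominated S G|.
Proof.
move=> good stn Ss.
have [|S' SS' cS'] := superset_of_card Ss; first by rewrite card_ord; lia.
apply: leq_trans (subset_leq_card (undominatedS G SS')).
rewrite ltnNge; apply: contra good => Ut.
have US : undominated S' G \subset ~: S'.
  by apply/subsetP => v; rewrite !inE => /andP[].
have [||T' UT' cT'] := @superset_of_card _ (undominated S' G :|: S') (s + t).
- apply: leq_trans (leq_card_setU _ _) _; rewrite cS'; lia.
- by rewrite card_ord.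
apply/existsP; exists (S', T' :\: S') => /=.
have ST' : S' \subset T' by apply: subset_trans UT'; exact: subsetUr.
rewrite cardsD (setIidPr ST') cT' cS' addKn !eqxx !andbT.
apply/andP; split.
  by rewrite disjoint_sym disjoints_subset; apply/subsetP => v; rewrite !inE => /andP[].
apply/dominatesP => v; rewrite !inE negb_or negb_and negbK => /andP[vS /orP[|vT]].
  by rewrite (negPf vS).
have : v \notin undominated S' G.
  by apply: contra vT => vU; apply: (subsetP UT'); rewrite inE vU.
rewrite inE vS /= negb_forall_in => /exists_inP[u uS]; rewrite negbK => uv.
by exists u.
Qed.

(** Induced paths, with the most recently added vertex at the head, so that
    depth first search can use them as its stack. *)
Fixpoint ipath G (s : seq 'I_n) :=
  if s is x :: s' then
    [&& ipath G s', x \notin s' &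
        if s' is y :: s'' then adj G x y && all (fun z => ~~ adj G x z) s'' else true]
  else true.

Lemma ipath_uniq G s : ipath G s -> uniq s.
Proof. by elim: s => //= x s IH /and3P[/IH -> -> _]. Qed.

Lemma ipath_nth G s x0 i j : ipath G s -> i < j < size s ->
  adj G (nth x0 s i) (nth x0 s j) = (j == i.+1).
Proof.
elim: s i j => [|x s IH] i j; first by rewrite andbF.
move=> /= /and3P[ps _ h] /andP[ij js].
case: j ij js => // j ij js; case: i ij => [_|i ij] /=; last by rewrite IH // -ltnS ij.
case: s h js {IH ps} => // y s /andP[xy /allP h] js.
case: j js => [|j js] /=; first by rewrite xy.
by apply/negbTE/h; rewrite mem_nth.
Qed.

(** Depth first search, with an induced path [S] as stack and a set [D] of dead
    vertices. If some vertex outside [S] and [D] is adjacent to the top [y] of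
    the stack and to nothing else in it, push it; otherwise [y] dies. The
    invariant is that no dead vertex is adjacent to a vertex which is outside
    [D] and not dominated by [S]: when [y] dies, each of its neighbours
    outside [S] and [D] has another neighbour on the stack. As long as the stack has at most [s]
    vertices it leaves more than [t] vertices undominated, so at the moment when
    [a] vertices are dead there would be [b] further vertices without edges to
    them. Hence the stack must first reach size [s]. *)
Lemma exists_ipath s t (a b : nat) G : ~~ bad_dominating s t G -> ~~ bad_separated a b G ->
  s + t <= n -> a + b <= t -> exists2 p : seq 'I_n, ipath G p & size p = s.
Proof.
move=> gd gs stn abt.
(* Both moves increase [size S + 2 * #|D|] by one, and this quantity is at most
   [2 * n]; so [k] bounds the number of moves still to come. *)
suff H k (S : seq 'I_n) (D : {set 'I_n}) : ipath G S -> size S <= s -> #|D| <= a ->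
    (forall x, x \in S -> x \notin D) ->
    (forall v u, v \in D -> u \notin D -> u \in undominated [set x in S] G -> ~~ adj G v u) ->
    n.*2 < size S + #|D|.*2 + k -> exists2 p : seq 'I_n, ipath G p & size p = s.
  apply: (H n.*2.+1 [::] set0) => //; rewrite ?cards0 //.
  by move=> v u; rewrite inE.
elim: k S D => [|k IH] S D pS Ss Da SD inv meas.
  have cS : #|[set x in S]| = size S.
    by rewrite cardsE; apply/card_uniqP; exact: ipath_uniq pS.
  have /subset_leq_card : [set x in S] \subset ~: D.
    by apply/subsetP => x; rewrite !inE => /SD.
  have := cardsC D; rewrite card_ord cS.
  by have := leq_addr #|~: D| #|D|; lia.
case: (ltngtP (size S) s) Ss => // [Ss _|sS _]; last by exists S.
have cS : #|[set x in S]| = size S.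
  by rewrite cardsE; apply/card_uniqP; exact: ipath_uniq pS.
have cU : t < #|undominated [set x in S] G|.
  by apply: card_undominated gd stn _; rewrite cS ltnW.
case: (ltngtP #|D| a) Da => // [Da _|cD _]; last first.
  case/negP: gs.
  have [|Y YU cY] := @subset_of_card _ (undominated [set x in S] G :\: D) b.
    rewrite -(leq_add2r #|D|); apply: leq_trans (_ : t <= _); first by lia.
    have := cardsID D (undominated [set x in S] G).
    have := subset_leq_card (subsetIr (undominated [set x in S] G) D).
    by move: cU; lia.
  apply/existsP; exists (D, Y) => /=; rewrite cY cD !eqxx /= andbT.
  apply/andP; split.
    rewrite disjoint_sym disjoints_subset; apply/subsetP => v /(subsetP YU).
    by rewrite !inE => /andP[].
  apply/separatedP => v u vD /(subsetP YU); rewrite inE => /andP[uD uU].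
  exact: inv.
have push u : u \notin D -> ipath G (u :: S) ->
    exists2 p : seq 'I_n, ipath G p & size p = s.
  move=> uD puS; apply: (IH (u :: S) D) => //=; first by rewrite ltnW.
  - by move=> x; rewrite inE => /orP[/eqP -> //|/SD].
  - move=> v z vD zD zU; apply: inv => //; apply: subsetP zU; apply: undominatedS.
    by apply/subsetP => x; rewrite !inE => ->; rewrite orbT.
  - by rewrite !addSn -addnS.
case: S pS Ss SD inv meas cS cU push => [|y S] pS Ss SD inv meas cS cU push.
  have /existsP[u uD] : [exists u, u \notin D].
    rewrite -negb_forall; apply/negP => /forallP h.
    have : #|[set: 'I_n]| <= #|D| by apply/subset_leq_card/subsetP => x _; exact: h.
    by rewrite cardsT card_ord; lia.
  by apply: (push u).
case: (boolP [exists u, [&& u \notin y :: S, u \notin D, adj G y u &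
                           all (fun z => ~~ adj G u z) S]]).
  case/existsP => u /and4P[uS uD yu h]; apply: (push u) => //.
  by rewrite [ipath _ _]/= -/(ipath G (y :: S)) pS uS adjC yu.
rewrite negb_exists => /forallP dead.
move: pS => /= /and3P[pS yS _].
apply: (IH S (y |: D)) => //; first exact: ltnW (ltnW Ss).
- by rewrite cardsU1 SD ?inE ?eqxx // add1n.
- move=> x xS; rewrite !inE negb_or SD ?inE ?xS ?orbT // andbT.
  by apply: contra yS => /eqP <-.
- move=> v u; rewrite !inE negb_or => vD /andP[uy uD] /andP[uS /forall_inP uN].
  have nyu : ~~ adj G y u.
    apply/negP => yu; have := dead u; rewrite !inE negb_or uy uS uD yu /=.
    by move/negP; apply; apply/allP => z zS; rewrite adjC uN // inE.
  case/orP: vD => [/eqP -> //|vD]; apply: inv => //.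
  rewrite !inE negb_or uy uS /=; apply/forall_inP => z; rewrite !inE.
  by case/orP => [/eqP -> //|zS]; apply: uN; rewrite inE.
- rewrite cardsU1 SD ?inE ?eqxx // add1n; apply: leq_trans meas _; rewrite [size _]/= doubleS !addnS !addSn; lia.
Qed.

(** * Holes *)

Lemma next_nth_uniq (c : seq 'I_n) x0 i : uniq c -> i < size c ->
  next c (nth x0 c i) = nth x0 c (if i.+1 == size c then 0 else i.+1).
Proof.
move=> uc ic; rewrite next_nth mem_nth //.
case: c uc ic => // x c uc ic; rewrite index_uniq //.
case: eqP => [/eq_add_S -> /=|ne]; first by rewrite nth_default.
rewrite [RHS]/=; apply: set_nth_default; move: ic ne => /=; lia.
Qed.

(** Adjacency along a cycle in terms of positions: the pair of first and last
    position is the only one that wraps around. *)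
Lemma cyclic_adj (c : seq 'I_n) x0 i j : uniq c -> 2 < size c -> i < j < size c ->
  (nth x0 c j == next c (nth x0 c i)) || (nth x0 c i == next c (nth x0 c j)) =
  (j == i.+1) || (i == 0) && (j == (size c).-1).
Proof.
move=> uc c2 /andP[ij jc]; have ic := ltn_trans ij jc.
have c0 : 0 < size c by lia.
have succ k : k < size c -> (if k.+1 == size c then 0 else k.+1) < size c.
  by move=> kc; case: eqP => // /eqP; rewrite ltn_neqAle => ->.
rewrite !next_nth_uniq // !nth_uniq ?succ //.
have -> : (i.+1 == size c) = false by apply/eqP; lia.
congr (_ || _); case: (eqVneq j.+1 (size c)) => h.
  by have -> : j == (size c).-1; [apply/eqP; lia | rewrite andbT].
have -> : (j == (size c).-1) = false by apply/eqP; lia.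
by rewrite andbF; apply/eqP; lia.
Qed.

Lemma hole_seq G (S : {set 'I_n}) x0 : induced_cycle G S ->
  exists c : seq 'I_n, [/\ uniq c, size c = #|S| &
    forall i j, i < j < size c ->
      adj G (nth x0 c i) (nth x0 c j) = (j == i.+1) || (i == 0) && (j == (size c).-1)].
Proof.
move=> /andP[S3 /existsP[c /and3P[uc /eqP cS /forall_inP h]]].
exists c; split; rewrite ?size_tuple // => i j ijc.
have inS k : k < #|S| -> nth x0 c k \in S.
  move=> kS; have : nth x0 c k \in [set x in c] by rewrite inE mem_nth ?size_tuple.
  by rewrite cS.
have iS : i < #|S| by lia.
have jS : j < #|S| by lia.
have /forall_inP/(_ _ (inS j jS))/eqP -> := h _ (inS i iS).
by rewrite cyclic_adj ?size_tuple.
Qed.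

Lemma leq_L_hole G (c : seq 'I_n) x0 : uniq c -> 2 < size c ->
  (forall i j, i < j < size c ->
    adj G (nth x0 c i) (nth x0 c j) = (j == i.+1) || (i == 0) && (j == (size c).-1)) ->
  size c <= L_hole G.
Proof.
move=> uc c2 h.
have cS : size c = #|[set x in c]| by rewrite cardsE; apply/esym/card_uniqP.
rewrite {1}cS; apply: leq_bigmax_cond.
apply/andP; split; first by rewrite -cS.
apply/existsP; exists (tcast cS (in_tuple c)); rewrite val_tcast.
apply/and3P; split=> //; first by apply/eqP/setP => x; rewrite !inE memtE val_tcast.
apply/forall_inP => x; rewrite inE => /(nthP x0)[i ic <-].
apply/forall_inP => y; rewrite inE => /(nthP x0)[j jc <-].
case: (ltngtP i j) => [ij|ji|<-].
- by rewrite h ?ij // cyclic_adj ?ij.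
- by rewrite adjC [X in _ == X]orbC h ?ji // cyclic_adj ?ji.
- have si : (if i.+1 == size c then 0 else i.+1) < size c.
    by case: eqP => // /eqP; [lia | rewrite ltn_neqAle => ->].
  rewrite adj_irr orbb next_nth_uniq // nth_uniq //.
  rewrite eq_sym eqbF_neg; case: (eqVneq i.+1 (size c)) => [e|_].
    by rewrite -lt0n -ltnS e; apply: ltn_trans c2.
  by rewrite neq_ltn ltnSn.
Qed.

(** On an induced path or cycle these vertices form an independent set. *)
Definition every_other (c : seq 'I_n) x0 o k : {set 'I_n} :=
  [set nth x0 c (o + (i : nat).*2) | i : 'I_k].

Lemma card_every_other (c : seq 'I_n) x0 o k : uniq c -> o + k.*2 <= (size c).+1 ->
  #|every_other c x0 o k| = k.
Proof.
move=> uc okc; rewrite card_in_imset ?card_ord // => i j _ _ /eqP.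
have := ltn_ord i; have := ltn_ord j => jk ik.
have bd (k' : nat) : k' < k -> o + k'.*2 < size c by lia.
by rewrite nth_uniq ?bd // => /eqP h; apply: val_inj => /=; lia.
Qed.

(** A hole with at least [4 * k] vertices contains an independent set of size
    [2 * k]: take every other vertex, and cut the result into two halves. *)
Lemma long_hole_isolated G k : 0 < k -> k.*2.*2 <= L_hole G -> bad_isolated k k G.
Proof.
move=> k0 kL.
have [S hS LS] : exists2 S : {set 'I_n}, induced_cycle G S & L_hole G = #|S|.
  have h : 0 < #|[pred S : {set 'I_n} | induced_cycle G S]|.
    apply/card_gt0P/existsP; apply: contraTT kL => /existsPn h.
    rewrite -ltnNge /L_hole big_pred0; first by rewrite -!muln2; lia.
    by move=> S; apply/negbTE/h.
  have [S hS E] := eq_bigmax_cond (fun S : {set 'I_n} => #|S|) h.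
  by exists S; [exact: hS | rewrite -E; apply: eq_bigl].
have /card_gt0P[x0 _] : 0 < #|S| by rewrite -LS; lia.
have [c [uc cS adjc]] := hole_seq x0 hS.
have kc : k.*2.*2 <= size c by rewrite cS -LS.
have nadj i j : i < j -> j.+1 < size c -> j != i.+1 ->
    ~~ adj G (nth x0 c i) (nth x0 c j) /\ ~~ adj G (nth x0 c j) (nth x0 c i).
  move=> ij jc /negPf ji; rewrite [X in _ /\ ~~ X]adjC adjc; last by lia.
  by rewrite ji; split; apply/negP => /andP[_ /eqP]; lia.
have nadj2 i j : i.*2.+1 < size c -> j.*2.+1 < size c ->
    ~~ adj G (nth x0 c i.*2) (nth x0 c j.*2).
  move=> ic jc; case: (ltngtP i j) => [ij|ji|->]; last by rewrite adj_irr.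
  - by apply: (nadj _ _ _ _ _).1; rewrite ?ltn_double //; apply/eqP; lia.
  - by apply: (nadj _ _ _ _ _).2; rewrite ?ltn_double //; apply/eqP; lia.
apply/existsP; exists (every_other c x0 0 k, every_other c x0 k.*2 k) => /=.
rewrite !card_every_other ?eqxx ?andbT //; try lia.
apply/andP; split.
  rewrite disjoints_subset; apply/subsetP => _ /imsetP[i _ ->]; rewrite inE.
  apply/negP => /imsetP[j _ /eqP]; have := ltn_ord i; have := ltn_ord j.
  move=> jk ik; have [b1 b2] : 0 + i.*2 < size c /\ k.*2 + j.*2 < size c by lia.
  by rewrite nth_uniq // => /eqP; lia.
apply/separatedP => _ y /imsetP[i _ ->]; rewrite add0n inE => yXY.
have ik := ltn_ord i.
have [j jc ->] : exists2 j, j.*2.+1 < size c & y = nth x0 c j.*2.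
  case/orP: yXY => /imsetP[j _ ->]; have jk := ltn_ord j.
    by exists j; rewrite ?add0n //; lia.
  by exists (k + j); rewrite ?doubleD //; lia.
by apply: nadj2 => //; lia.
Qed.

(** Take the last neighbour of [w] in the initial part of the path and its
    first neighbour in the final part; together with [w], the stretch between
    them is an induced cycle containing the middle part. *)
Lemma hole_of_ipath G (p : seq 'I_n) w x0 A m : ipath G p -> w \notin p ->
  size p = A + m + A -> 0 < m ->
  (exists2 i, i < A & adj G w (nth x0 p i)) ->
  (exists2 j, A + m <= j < size p & adj G w (nth x0 p j)) ->
  (forall k, A <= k < A + m -> ~~ adj G w (nth x0 p k)) ->
  m <= L_hole G.
Proof.
move=> pp wp sp m0 [i1 i1A wi1] [j1 j1p wj1] mid.
pose Pi i := (i < A) && adj G w (nth x0 p i).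
have exi : exists i, Pi i by exists i1; rewrite /Pi i1A.
have lei i : Pi i -> i <= A by case/andP => /ltnW.
case: (ex_maxnP exi lei) => i /andP[iA wi] imax.
pose Pj j := (A + m <= j < size p) && adj G w (nth x0 p j).
have exj : exists j, Pj j by exists j1; rewrite /Pj j1p.
case: (ex_minnP exj) => j /andP[/andP[jA jp] wj] jmin.
have between k : i < k < j -> ~~ adj G w (nth x0 p k).
  move=> /andP[ik kj]; case: (ltnP k A) => kA.
    by apply/negP => wk; have := imax k; rewrite /Pi kA wk => /(_ isT); lia.
  case: (ltnP k (A + m)) => kAm; first by apply: mid; rewrite kA.
  apply/negP => wk; have := jmin k; rewrite /Pj kAm wk; lia.
pose q := take (j - i).+1 (drop i p).
have sq : size q = (j - i).+1.
  by rewrite /q size_takel // size_drop; lia.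
have nq k : k <= j - i -> nth x0 q k = nth x0 p (i + k).
  by move=> kji; rewrite /q nth_take // nth_drop.
apply: leq_trans (_ : size (w :: q) <= _); first by rewrite /= sq; lia.
apply: (@leq_L_hole _ _ x0).
- rewrite /= take_uniq ?drop_uniq ?(ipath_uniq pp) // andbT.
  by apply: contra wp => /mem_take/mem_drop.
- by rewrite /= sq; lia.
move=> s t /andP[]; case: t => // t st; rewrite [size _]/= sq ltnS => tji.
case: s st => [_|s st]; rewrite [nth x0 _ t.+1]/= nq //.
  rewrite [nth x0 _ 0]/= !eqSS /=.
  case: t tji => [|t] tji; first by rewrite addn0 wi.
  case: (eqVneq t.+1 (j - i)) => [e|ne].
    by rewrite e subnKC ?wj //; lia.
  by apply/negbTE/between; lia.
rewrite [nth x0 _ s.+1]/= nq ?(ipath_nth _ pp) ?orbF ?eqSS //; last lia.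
  by apply/eqP/eqP; lia.
by lia.
Qed.

(** Closing a path [A ++ M ++ B]. More than [t] vertices are not dominated by
    [M], more than [2 * b] of them off the path. If each of these missed [A] or
    missed [B], then at least [b] of them would miss the same end, which contains the independent set of every other
    vertex, of size [a]. So some vertex is adjacent to both ends but not to
    [M]. *)
Lemma long_hole G (m a b t : nat) : ~~ bad_dominating m t G -> ~~ bad_isolated a b G ->
  (exists2 p : seq 'I_n, ipath G p & size p = a.*2 + m + a.*2) ->
  m + t <= n -> 0 < m -> b.*2 + a.*2.*2 <= t -> m <= L_hole G.
Proof.
move=> gd gi [p pp sp] mtn m0 bat.
have /card_gt0P[x0 _] : 0 < #|'I_n| by rewrite card_ord; lia.
have up := ipath_uniq pp.
pose A := take a.*2 p; pose M := take m (drop a.*2 p); pose B := drop (a.*2 + m) p.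
pose U := undominated [set x in M] G :\: [set x in A ++ B].
have sA : size A = a.*2 by rewrite size_takel // sp -addnA leq_addr.
have sM : size M = m by rewrite size_takel // size_drop sp -addnA addKn leq_addr.
have sB : size B = a.*2 by rewrite size_drop sp addKn.
have cU : b.*2 < #|U|.
  have h0 : t < #|undominated [set x in M] G|.
    apply: card_undominated gd mtn _; rewrite cardsE.
    by apply: leq_trans (card_size _) _; rewrite sM.
  have h1 : #|[set x in A ++ B]| <= a.*2.*2.
    rewrite cardsE; apply: leq_trans (card_size _) _.
    by rewrite size_cat sA sB addnn.
  have h2 := subset_leq_card (subsetIr (undominated [set x in M] G) [set x in A ++ B]).
  rewrite -(ltn_add2r a.*2.*2); apply: leq_ltn_trans bat (leq_trans h0 _).
  by rewrite -(cardsID [set x in A ++ B]) addnC leq_add2l (leq_trans h2 h1).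
have half (o : nat) : o = 0 \/ o = a.*2 + m ->
    #|[set v in U | [forall i : 'I_a.*2, ~~ adj G v (nth x0 p (o + i))]]| < b.
  move=> oE; rewrite ltnNge; apply: contra gi => bU.
  have [Y YU cY] := subset_of_card bU.
  have YP y (i : nat) : y \in Y -> i < a.*2 -> ~~ adj G y (nth x0 p (o + i)).
    move=> /(subsetP YU); rewrite inE => /andP[_ /forallP h] ia.
    exact: h (Ordinal ia).
  have pAB (i : nat) : i < a.*2 -> nth x0 p (o + i) \in A ++ B.
    move=> ia; rewrite mem_cat; case: oE => ->.
      apply/orP; left; by rewrite add0n -(nth_take x0 ia) mem_nth // sA.
    by apply/orP; right; rewrite -nth_drop mem_nth // sB.
  apply/existsP; exists (every_other p x0 o a, Y) => /=.
  rewrite card_every_other ?cY ?eqxx ?andbT //; last by case: oE => ->; lia.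
  apply/andP; split.
    rewrite disjoints_subset; apply/subsetP => _ /imsetP[i _ ->]; rewrite inE.
    apply/negP => /(subsetP YU); rewrite !inE pAB //; have := ltn_ord i; lia.
  apply/separatedP => _ y /imsetP[i _ ->]; have ia := ltn_ord i.
  rewrite inE => /orP[/imsetP[j _ ->]|yY]; last by rewrite adjC; apply: YP => //; lia.
  have ja := ltn_ord j.
  case: (ltngtP i j) => [ij|ji|->]; last by rewrite adj_irr.
    by rewrite (ipath_nth _ pp); [apply/eqP|case: oE => ->]; lia.
  by rewrite adjC (ipath_nth _ pp); [apply/eqP|case: oE => ->]; lia.
have /existsP[w /andP[wU /andP[wA wB]]] : [exists w, (w \in U) &&
    ([exists i : 'I_a.*2, adj G w (nth x0 p (0 + i))] &&
     [exists i : 'I_a.*2, adj G w (nth x0 p (a.*2 + m + i))])].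
  apply: contraTT cU => /existsPn h; rewrite -leqNgt.
  have hA := half 0 (or_introl erefl); have hB := half _ (or_intror erefl).
  set UA := [set v in U | _] in hA; set UB := [set v in U | _] in hB.
  have sub : U \subset UA :|: UB.
    apply/subsetP => v vU; have := h v; rewrite vU /= negb_and !negb_exists.
    by move=> /orP[] hv; rewrite inE; apply/orP; [left|right]; rewrite inE vU.
  apply: leq_trans (subset_leq_card sub) (leq_trans (leq_card_setU _ _) _).
  by rewrite -addnn leq_add // ltnW.
move: wU; rewrite inE [_ \in undominated _ _]inE !inE => /andP[wAB /andP[wM /forall_inP wnM]].
apply: (@hole_of_ipath G p w x0 a.*2 m) => //.
- have -> : p = A ++ M ++ B.
    by rewrite /A /M /B addnC -drop_drop !cat_take_drop.
  by rewrite !mem_cat in wAB *; move: wAB wM; rewrite !negb_or => /andP[-> ->] ->.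
- by case/existsP: wA => i wi; exists i.
- case/existsP: wB => i wi; exists (a.*2 + m + i) => //; have := ltn_ord i; lia.
- move=> k /andP[ak km]; rewrite adjC; apply: wnM; rewrite inE.
  have -> : nth x0 p k = nth x0 M (k - a.*2).
    by rewrite /M nth_take ?nth_drop ?subnKC //; lia.
  by rewrite mem_nth // sM; lia.
Qed.

End Graph.

(** * Existence of regular graphs *)

Import GRing.Theory.

Section Circulant.
Variable m : nat.
Local Open Scope ring_scope.

(** The circulant graph with connection set [J]. *)
Lemma circulant_regular (J : {set 'I_m.+1}) :
  (0 \notin J) -> (forall v, v \in J -> - v \in J) ->
  exists G : sgraph m.+1, regular G #|J|.
Proof.
move=> J0 JN.
pose E := [set e : {set 'I_m.+1} | [exists x, exists y, (e == [set x; y]) && (y - x \in J)]].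
have EP : [forall e in E, #|e| == 2].
  apply/forall_inP => e; rewrite inE => /existsP[x /existsP[y /andP[/eqP -> yx]]].
  rewrite cards2; by case: (eqVneq x y) yx => [->|//]; rewrite subrr (negPf J0).
pose G : sgraph m.+1 := exist _ E EP.
have adjE x y : adj G x y = (y - x \in J).
  rewrite /adj inE; apply/existsP/idP => [[a /existsP[b /andP[]]]|xy].
    rewrite eq_set2 => /orP[]/andP[/eqP -> /eqP ->] // /JN.
    by rewrite opprB.
  by exists x; apply/existsP; exists y; rewrite eqxx.
exists G; apply/forallP => x; apply/eqP.
rewrite /degree -(card_imset (mem J) (addrI x)); apply: eq_card => y.
rewrite in_set adjE.
apply/idP/imsetP => [yJ|[v vJ ->]]; first by exists (y - x); rewrite // addrC subrK.
by rewrite addrC addKr.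
Qed.

(** The residues [1, ..., d / 2] and their opposites, together with [n / 2] if
    [d] is odd, in which case [n] is even. *)
Lemma symmetric_set d : (d < m.+1)%N -> ~~ odd (m.+1 * d) ->
  exists J : {set 'I_m.+1}, [/\ 0 \notin J, forall v, v \in J -> - v \in J & #|J| = d].
Proof.
move=> dm par; pose h := d./2.
have dE : d = (odd d + h.*2)%N by rewrite odd_double_half.
have mE : odd d -> m.+1 = (m.+1)./2.*2.
  move=> od; rewrite -[LHS]odd_double_half; move: par; rewrite oddM od andbT => /negPf.
  by move=> ->.
pose P (v : nat) := [|| (0 < v <= h)%N, (m.+1 - h <= v)%N | odd d && (v.*2 == m.+1)].
pose J := [set v : 'I_m.+1 | P v].
have h0 : (m.+1 - h <= 0)%N = false by apply/negbTE; rewrite -ltnNge; lia.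
exists J; split.
- by rewrite inE /P /= h0 /= andbC.
- move=> v; rewrite !inE => vP.
  have v0 : (0 < v)%N.
    by rewrite lt0n; apply: contraL vP => /eqP ->; rewrite /P h0 /= andbC.
  have -> : nat_of_ord (- v) = (m.+1 - v)%N by rewrite /= modn_small // ltn_subrL v0.
  have vm := ltn_ord v.
  move: vP; rewrite /P => /or3P[vh|vh|/andP[-> v2]].
  - by apply/or3P/Or32; lia.
  - by apply/or3P/Or31; lia.
  - by apply/or3P/Or33; rewrite /=; lia.
- pose A := [set (inord i.+1 : 'I_m.+1) | i : 'I_h].
  pose B := [set (inord (m - i) : 'I_m.+1) | i : 'I_h].
  pose C := [set v : 'I_m.+1 | odd d && (v.*2 == m.+1)%N].
  have hd : (h.*2 <= d)%N by lia.
  have vA (i : 'I_h) : nat_of_ord (inord i.+1 : 'I_m.+1) = i.+1.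
    by rewrite inordK //; have := ltn_ord i; lia.
  have vB (i : 'I_h) : nat_of_ord (inord (m - i) : 'I_m.+1) = (m - i)%N.
    by rewrite inordK //; have := ltn_ord i; lia.
  have memA v : (v \in A) = (0 < v <= h)%N.
    apply/imsetP/idP => [[i _ ->]|/andP[v0 vh]].
      by rewrite vA; have := ltn_ord i; lia.
    have vh' : (v.-1 < h)%N by lia.
    by exists (Ordinal vh') => //; apply: val_inj; rewrite [RHS](vA (Ordinal vh')) /= prednK.
  have memB v : (v \in B) = (m.+1 - h <= v)%N.
    have vm := ltn_ord v.
    apply/imsetP/idP => [[i _ ->]|vh].
      by rewrite vB; have := ltn_ord i; lia.
    have vh' : (m - v < h)%N by lia.
    by exists (Ordinal vh') => //; apply: val_inj; rewrite [RHS](vB (Ordinal vh')) /=; lia.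
  have cA : #|A| = h.
    rewrite card_imset ?card_ord // => i j /(congr1 val) /=.
    by rewrite !vA => -[] /val_inj.
  have cB : #|B| = h.
    rewrite card_imset ?card_ord // => i j /(congr1 val) /=.
    rewrite !vB => E; apply: val_inj => /=; have := ltn_ord i; have := ltn_ord j; lia.
  have cC : #|C| = odd d.
    case od : (odd d); last first.
      by apply/eqP; rewrite cards_eq0; apply/eqP/setP => v; rewrite !inE od.
    rewrite /= -(cards1 (inord (m.+1)./2 : 'I_m.+1)); apply: eq_card => v.
    have me := mE od.
    have lt : ((m.+1)./2 < m.+1)%N by lia.
    rewrite !inE od /= -val_eqE /= inordK //; apply/eqP/eqP; lia.
  have -> : J = A :|: (B :|: C).
    by apply/setP => v; rewrite !inE memA memB.
  have dAB : [disjoint A & B :|: C].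
    rewrite disjoints_subset; apply/subsetP => v; rewrite memA !inE memB => vh.
    by rewrite negb_or; apply/andP; split; [|apply/negP => /andP[od /eqP]]; lia.
  have dBC : [disjoint B & C].
    rewrite disjoints_subset; apply/subsetP => v; rewrite memB !inE => vh.
    by apply/negP => /andP[od /eqP]; lia.
  rewrite !cardsU (disjoint_setI0 dAB) (disjoint_setI0 dBC) !cards0 cA cB cC.
  lia.
Qed.

End Circulant.

Lemma exists_regular n d : d < n -> ~~ odd (n * d) ->
  exists G : sgraph n, regular G d.
Proof.
case: n => // m dn par; have [J [J0 JN <-]] := symmetric_set dn par.
exact: circulant_regular J0 JN.
Qed.

(** * First moment estimates *)

From mathcomp Require Import all_classical all_reals all_analysis.
From mathcomp Require Import ring lra.
Import Order.TTheory GRing.Theory Num.Theory.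
Import numFieldNormedType.Exports.
Local Open Scope ring_scope.

Section Rare.
Variable R : realType.
Implicit Types (x y M : R) (n d : nat).

Lemma ler_1B_expR x : 1 - x <= expR (- x).
Proof. by have := expR_ge1Dx (- x). Qed.

Lemma expR_le_1B x : 0 <= x -> x <= 2^-1 -> expR (- (2 * x)) <= 1 - x.
Proof.
move=> x0 x2; rewrite expRN.
have h : 1 + 2 * x <= expR (2 * x) by exact: expR_ge1Dx.
have p : 0 < 1 + 2 * x by lra.
apply: le_trans (_ : (1 + 2 * x)^-1 <= _); first by rewrite lef_pV2 ?posrE ?expR_gt0.
by rewrite -[leLHS]mul1r ler_pdivrMr //; nra.
Qed.

(** The entropy bound, without any rounding: ['C(n, a) * x ^ a] is one of the
    terms of [(1 + x) ^ n <= expR (n * x)], and [x ^ a >= expR (- M * a)]. *)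
Lemma bin_le_expR n a x M : expR (- M) <= x -> 0 <= M -> a%:R <= x * n%:R ->
  'C(n, a)%:R <= expR (n%:R * (x * (1 + M))).
Proof.
move=> Mx M0 axn; have x0 : 0 < x := lt_le_trans (expR_gt0 _) Mx.
have [na|an] := ltnP n a; first by rewrite bin_small // ltW // expR_gt0.
have h1 : 'C(n, a)%:R * x ^+ a <= expR (n%:R * x).
  apply: le_trans (_ : (1 + x) ^+ n <= _); last first.
    rewrite mulrC expRM_natr lerXn2r ?nnegrE ?expR_ge0 ?expR_ge1Dx //; lra.
  rewrite exprDn (bigD1 (Ordinal (an : (a < n.+1)%N))) //= expr1n mul1r mulr_natl.
  by rewrite lerDl sumr_ge0 // => i _; rewrite expr1n mul1r mulrn_wge0 // exprn_ge0 // ltW.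
have h2 : expR (- (M * a%:R)) <= x ^+ a.
  by rewrite -mulNr expRM_natr lerXn2r ?nnegrE ?expR_ge0 // ltW.
apply: le_trans (_ : expR (n%:R * x) * expR (M * a%:R) <= _).
  rewrite -ler_pdivrMr ?expR_gt0 // -expRN.
  by apply: le_trans h1; rewrite ler_wpM2l.
by rewrite -expRD ler_expR; nra.
Qed.

Lemma le_1_expR M : 0 <= M -> expR (- M) <= 1 :> R.
Proof. by move=> M0; rewrite -expR0 ler_expR; lra. Qed.

(** Asymptotically negligible among the [d]-regular graphs. Multiplying out
    avoids dividing by the number of regular graphs, which may be zero. *)
Definition rare d (P : forall n, pred (sgraph n)) :=
  forall e : R, 0 < e -> exists N, forall n, (N <= n)%N ->
    (count_regular d (P n))%:R <= e * (count_regular d (@predT (sgraph n)))%:R.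

Lemma rareU d P Q : rare d P -> rare d Q -> rare d (fun n G => P n G || Q n G).
Proof.
move=> rP rQ e e0; have e2 : 0 < e / 2 by lra.
have [N hN] := rP _ e2; have [N' hN'] := rQ _ e2.
exists (maxn N N') => n; rewrite geq_max => /andP[Nn N'n].
have : (count_regular d (fun G => P n G || Q n G) <=
    count_regular d (P n) + count_regular d (Q n))%N.
  rewrite /count_regular; apply: leq_trans (leq_card_setU _ _).
  apply/subset_leq_card/fintype.subsetP => G; rewrite !inE.
  by case: (regular G d).
rewrite -(ler_nat R) natrD => /le_trans; apply.
by have := hN _ Nn; have := hN' _ N'n; lra.
Qed.

Lemma rare_exp d P (K g : R) N : 0 < g ->
  (forall n, (N <= n)%N -> (count_regular d (P n))%:R <=
     expR (K - g * n%:R) * (count_regular d (@predT (sgraph n)))%:R) ->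
  rare d P.
Proof.
move=> g0 h e e0.
pose N' := Num.bound (expR K / (g * e)).
exists (maxn N N'.+1) => n; rewrite geq_max => /andP[Nn N'n].
apply: le_trans (h n Nn) _; rewrite ler_wpM2r // expRD expRN.
have n0 : 0 < n%:R :> R by rewrite ltr0n; lia.
have gn : 0 < g * n%:R by rewrite mulr_gt0.
have h1 : g * n%:R <= expR (g * n%:R).
  by apply: le_trans (expR_ge1Dx _); lra.
apply: le_trans (_ : expR K * (g * n%:R)^-1 <= _).
  by rewrite ler_wpM2l ?expR_ge0 // lef_pV2 // posrE ?expR_gt0.
rewrite ler_pdivrMr // mulrCA mulrA -ler_pdivrMl ?mulr_gt0 // mulrC.
apply: le_trans (ltW (archi_boundP _)) _.
  by rewrite divr_ge0 ?expR_ge0 // ltW // mulr_gt0.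
by rewrite ler_nat; apply: ltnW.
Qed.

Lemma eventually_ge x y : 0 < x -> exists N, forall n, (N <= n)%N -> y <= x * n%:R.
Proof.
move=> x0; exists (Num.bound (`|y| / x)) => n Nn.
rewrite mulrC -ler_pdivrMr //; apply: le_trans (_ : `|y| / x <= _).
  by rewrite ler_pM2r ?invr_gt0 // ler_norm.
apply: le_trans (ltW (archi_boundP _)) _; last by rewrite ler_nat.
by rewrite divr_ge0 // ltW.
Qed.

Lemma subn_ratio_le n b c k : (c < n)%N -> (c <= b <= n)%N ->
  ((n - b)%N%:R : R) ^+ k <=
  (n - c)%N%:R ^+ k * expR (- (k%:R * ((b%:R - c%:R) / n%:R))).
Proof.
move=> cn /andP[cb bn].
have c0 : 0 < (n - c)%N%:R :> R by rewrite ltr0n subn_gt0.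
have n0 : 0 < n%:R :> R by rewrite ltr0n; lia.
rewrite -mulrN expRM_natl -exprMn lerXn2r ?nnegrE ?mulr_ge0 ?expR_ge0 ?ler0n //.
rewrite mulrC -ler_pdivrMr // !natrB ?(ltnW cn) //; rewrite natrB ?(ltnW cn) // in c0.
have -> : (n%:R - b%:R) / (n%:R - c%:R) = 1 - (b%:R - c%:R) / (n%:R - c%:R) :> R.
  by field; lra.
apply: le_trans (ler_1B_expR _) _; rewrite ler_expR lerN2.
have cb' : (c%:R : R) <= b%:R by rewrite ler_nat.
by rewrite ler_wpM2l ?subr_ge0 // lef_pV2 ?posrE // lerBlDr lerDl ler0n.
Qed.

Lemma expR_combine (A B E C T N : R) : 0 <= T -> 0 <= N -> A + B - E <= C ->
  expR A * expR B * (T * (N * expR (- E))) <= expR C * T * N.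
Proof.
move=> T0 N0 h; rewrite (_ : expR A * expR B * (T * (N * expR (- E))) = expR (A + B - E) * T * N).
  by rewrite ler_wpM2r // ler_wpM2r // ler_expR.
by rewrite !expRD; ring.
Qed.

(** First moment: [x * (1 + M)] and [y * (1 + M')] are the exponential rates of
    the numbers of choices of the two sets, and [d * x * y] is the rate at which
    the probability that a given pair is isolated decays. *)
Lemma rare_isolated d (a b : nat -> nat) (x y M M' : R) :
  0 < x -> 0 < y -> y <= 1 -> 0 <= M -> 0 <= M' ->
  expR (- M) <= x -> expR (- M') <= y ->
  (forall n, x * n%:R - 1 <= (a n)%:R <= x * n%:R) ->
  (forall n, y * n%:R - 1 <= (b n)%:R <= y * n%:R) ->
  x * (1 + M) + y * (1 + M') < d%:R * (x * y) ->
  rare d (fun n => bad_isolated (a n) (b n)).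
Proof.
move=> x0 y0 y1 M0 M'0 Mx My ha hb gap.
pose c := (d.+1.*2)%N.
have [N1 hN1] := eventually_ge (c%:R + 1) y0.
have [N2 hN2] := eventually_ge 1 x0.
pose g := d%:R * (x * y) - (x * (1 + M) + y * (1 + M')).
apply: (@rare_exp d _ (d%:R * (x * (1 + c%:R) + y)) g (maxn (maxn N1 N2) c.+1)).
  by rewrite subr_gt0.
move=> n; rewrite !geq_max => /andP[/andP[/hN1 n1 /hN2 n2] cn].
have /andP[a1 a2] := ha n; have /andP[b1 b2] := hb n.
have n0 : 0 < n%:R :> R by rewrite ltr0n; exact: leq_ltn_trans cn.
have cb : (c <= b n <= n)%N.
  by rewrite -!(ler_nat R); apply/andP; split; nra.
have := count_bad_isolated n d (a n) (b n).
rewrite -(ler_nat R) !natrM !natrX -/c.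
set T := (count_regular d predT)%:R; set X := (count_regular d _)%:R => h.
have T0 : 0 <= T by rewrite ler0n.
have h2 := subn_ratio_le (d * a n) cn cb.
set k := (d * a n)%N in h h2.
have c0 : 0 < ((n - c)%N%:R : R) ^+ k by rewrite exprn_gt0 // ltr0n subn_gt0.
rewrite -(ler_pM2r c0); apply: le_trans h _.
have B1 := bin_le_expR Mx M0 a2; have B2 := bin_le_expR My M'0 b2.
have BB : ('C(n, a n)%:R * 'C(n, b n)%:R : R) <=
    expR (n%:R * (x * (1 + M))) * expR (n%:R * (y * (1 + M'))).
  by apply: ler_pM; rewrite ?ler0n.
have TT : T * (n - b n)%N%:R ^+ k <= T * ((n - c)%N%:R ^+ k *
    expR (- (k%:R * (((b n)%:R - c%:R) / n%:R)))) by rewrite ler_wpM2l.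
have BT := ler_pM _ _ BB TT; apply: le_trans (BT _ _) _.
- by rewrite mulr_ge0 ?ler0n.
- by rewrite mulr_ge0 // exprn_ge0 ?ler0n.
apply: expR_combine; rewrite ?(ltW c0) //.
have key : d%:R * ((x * n%:R - 1) * (y * n%:R - 1 - c%:R)) <=
    k%:R * ((b n)%:R - c%:R).
  rewrite /k natrM -mulrA ler_wpM2l ?ler0n //.
  by apply: ler_pM; lra.
have key2 : d%:R * (x * y) * n%:R - d%:R * (x * (1 + c%:R) + y) <=
    k%:R * (((b n)%:R - c%:R) / n%:R).
  rewrite [leRHS]mulrA ler_pdivlMr //; apply: le_trans key.
  have : 0 <= d%:R * (1 + c%:R) :> R by rewrite mulr_ge0 ?ler0n // addr_ge0 ?ler0n.
  by nra.
by rewrite /g; lra.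
Qed.

(** First moment: each of at least [n / 2] vertices has, conditionally on the
    preceding ones, probability at least [(1 - 3 * x) ^ d] of not being
    dominated. *)
Lemma rare_dominating d (s t : nat -> nat) (x y M M' : R) :
  0 < x -> 0 < y -> 3 * x <= 2^-1 -> x + y <= 2^-1 -> 0 <= M -> 0 <= M' ->
  expR (- M) <= x -> expR (- M') <= y ->
  (forall n, (s n)%:R <= x * n%:R) ->
  (forall n, (t n)%:R <= y * n%:R) ->
  x * (1 + M) + y * (1 + M') < (1 - 3 * x) ^+ d / 2 ->
  rare d (fun n => bad_dominating (s n) (t n)).
Proof.
move=> x0 y0 x3 xy M0 M'0 Mx My hs ht gap.
have [N1 hN1] := eventually_ge (d.+1.*2)%:R x0.
pose g := (1 - 3 * x) ^+ d / 2 - (x * (1 + M) + y * (1 + M')).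
apply: (@rare_exp d _ 0 g (maxn N1 1)); first by rewrite subr_gt0.
move=> n; rewrite !geq_max => /andP[/hN1 n1 n1'].
have n0 : 0 < n%:R :> R by rewrite ltr0n.
have := hs n; have := ht n => t2 s2.
have := count_bad_dominating n d (s n) (t n).
rewrite -(ler_nat R) !natrM !natrX.
set T := (count_regular d predT)%:R; set X := (count_regular d _)%:R => h.
set m := (n - (s n + t n))%N in h.
have T0 : 0 <= T by rewrite ler0n.
have nd0 : 0 < (n%:R : R) ^+ d by rewrite exprn_gt0.
have c0 : 0 < ((n%:R : R) ^+ d) ^+ m by rewrite exprn_gt0.
rewrite -(ler_pM2r c0); apply: le_trans h _.
set q := (n - _)%N.
have q1 : (1 - 3 * x) * n%:R <= q%:R.
  have : (n%:R : R) <= q%:R + ((s n + d.+1).*2)%:R.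
    by rewrite -natrD ler_nat addnC -leq_subLR.
  rewrite -!muln2 !natrM natrD in n1 *; lra.
have q2 : ((1 - 3 * x) * n%:R) ^+ d <= (q%:R : R) ^+ d.
  by rewrite lerXn2r ?nnegrE ?ler0n //; nra.
have qn : (q ^ d <= n ^ d)%N.
  by have [->|d0] := posnP d; rewrite ?expn0 // leq_exp2r // leq_subr.
have r1 : (n ^ d - q ^ d)%N%:R <= n%:R ^+ d * expR (- (1 - 3 * x) ^+ d) :> R.
  rewrite natrB // !natrX; apply: le_trans (_ : n%:R ^+ d * (1 - (1 - 3 * x) ^+ d) <= _).
    by rewrite mulrBr mulr1 lerB // mulrC -exprMn.
  by rewrite ler_wpM2l ?(ltW nd0) // ler_1B_expR.
have r2 : (n ^ d - q ^ d)%N%:R ^+ m <=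
    (n%:R ^+ d) ^+ m * expR (- ((1 - 3 * x) ^+ d * m%:R)) :> R.
  by rewrite -mulNr expRM_natr -exprMn lerXn2r ?nnegrE ?ler0n //.
have B1 := bin_le_expR Mx M0 s2; have B2 := bin_le_expR My M'0 t2.
have BB : ('C(n, s n)%:R * 'C(n, t n)%:R : R) <=
    expR (n%:R * (x * (1 + M))) * expR (n%:R * (y * (1 + M'))).
  by apply: ler_pM; rewrite ?ler0n.
have TT : T * (n ^ d - q ^ d)%N%:R ^+ m <= T * ((n%:R ^+ d) ^+ m *
    expR (- ((1 - 3 * x) ^+ d * m%:R))) by rewrite ler_wpM2l.
have BT := ler_pM _ _ BB TT; apply: le_trans (BT _ _) _.
- by rewrite mulr_ge0 ?ler0n.
- by rewrite mulr_ge0 // exprn_ge0 ?ler0n.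
apply: expR_combine; rewrite ?(ltW c0) //.
have m2 : n%:R / 2 <= m%:R :> R.
  have : (n%:R : R) <= m%:R + (s n + t n)%:R by rewrite -natrD ler_nat addnC -leq_subLR.
  rewrite natrD; nra.
have d3 : 0 <= (1 - 3 * x) ^+ d by rewrite exprn_ge0 //; lra.
have := ler_wpM2l d3 m2.
by rewrite /g; nra.
Qed.

(** First moment: each vertex of the first set costs a factor at most
    [4 / (d * x) <= expR (- T)], against an entropy of about [1 + M] for each of
    the two sets. *)
Lemma rare_separated d (a : nat -> nat) (x M T : R) :
  0 < x -> x <= 16^-1 -> 0 <= M -> 0 <= T -> expR (- M) <= x ->
  (forall n, x * n%:R - 1 <= (a n)%:R <= x * n%:R) ->
  4 <= d%:R * x * expR (- T) -> 2 * (1 + M) < T ->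
  rare d (fun n => bad_separated (a n) (a n)).
Proof.
move=> x0 x16 M0 T0 Mx ha hT gap.
have [N1 hN1] := eventually_ge (8 * (d.+2.*2)%:R) (ltr01 : 0 < 1 :> R).
have [N2 hN2] := eventually_ge 2 x0.
pose g := T * x - 2 * (x * (1 + M)).
apply: (@rare_exp d _ T g (maxn (maxn N1 N2) 1)).
  by rewrite /g; nra.
move=> n; rewrite !geq_max => /andP[/andP[/hN1 n1 /hN2 n2] n1'].
have n0 : 0 < n%:R :> R by rewrite ltr0n.
have /andP[a1 a2] := ha n.
set c := (d.+2.*2)%N in n1.
have := @count_bad_separated n d (a n) (a n) _ (leqnn _).
rewrite -/c; set m := (a n + a n + c)%N.
rewrite -(ler_nat R) !natrM !natrX !natrM.
set X0 := (count_regular d predT)%:R; set X := (count_regular d _)%:R => h.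
have X00 : 0 <= X0 by rewrite ler0n.
have m1 : n%:R / 2 <= (n - m.*2)%N%:R :> R.
  have : (n%:R : R) <= (n - m.*2)%N%:R + (m.*2)%:R by rewrite -natrD ler_nat addnC -leq_subLR.
  rewrite -!muln2 !natrM !natrD; nra.
have f1 : n%:R ^+ 2 * expR T <= d%:R * (a n)%:R * (n - m.*2)%N%:R :> R.
  have T4 : 4 * expR T <= d%:R * x.
    by rewrite -ler_pdivlMr ?expR_gt0 // -expRN.
  have e1 : 4 * expR T * n%:R <= d%:R * x * n%:R by rewrite ler_wpM2r // ltW.
  have e2 : d%:R * (x * n%:R) <= 2 * (d%:R * (a n)%:R) :> R.
    by rewrite [leRHS]mulrCA ler_wpM2l ?ler0n //; lra.
  have e3 : 2 * expR T * n%:R <= d%:R * (a n)%:R by lra.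
  have e4 := ler_pM _ _ e3 m1; apply: le_trans (e4 _ _); first by lra.
  - by rewrite !mulr_ge0 ?expR_ge0 ?ler0n.
  - by rewrite divr_ge0 ?ler0n.
have nn0 : 0 < (n%:R : R) ^+ 2 by rewrite exprn_gt0.
have c0 : 0 < ((n%:R : R) ^+ 2) ^+ a n by rewrite exprn_gt0.
have f2 : (n%:R ^+ 2 * expR T) ^+ a n <= (d%:R * (a n)%:R * (n - m.*2)%N%:R) ^+ a n :> R.
  by rewrite lerXn2r ?nnegrE ?mulr_ge0 ?expR_ge0 ?ler0n ?(ltW nn0).
have h' : X * (n%:R ^+ 2 * expR T) ^+ a n <=
    'C(n, a n)%:R * 'C(n, a n)%:R * (X0 * (n%:R ^+ 2) ^+ a n).
  by apply: le_trans h; rewrite ler_wpM2l ?ler0n.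
rewrite exprMn -expRM_natr in h'.
have {}h' : X * expR (T * (a n)%:R) <= 'C(n, a n)%:R * 'C(n, a n)%:R * X0.
  by rewrite -(ler_pM2r c0) -[leLHS]mulrA (mulrC (expR _)) -[leRHS]mulrA.
have B1 := bin_le_expR Mx M0 a2.
have BB : ('C(n, a n)%:R * 'C(n, a n)%:R : R) <=
    expR (n%:R * (x * (1 + M))) * expR (n%:R * (x * (1 + M))).
  by apply: ler_pM; rewrite ?ler0n.
rewrite -(ler_pM2r (expR_gt0 (T * (a n)%:R))); apply: le_trans h' _.
rewrite [leRHS]mulrAC -expRD; rewrite -expRD in BB.
apply: ler_wpM2r => //; apply: le_trans BB _; rewrite ler_expR.
have := ler_wpM2l T0 a1; rewrite /g; lra.
Qed.

End Rare.

(** * Choice of the parameters *)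

Section Rates.
Variable R : realType.
Implicit Types (x y z w u L : R) (n d : nat).

Definition floorn z n := Num.truncn (z * n%:R).

Lemma floorn_le z n : 0 <= z -> (floorn z n)%:R <= z * n%:R.
Proof. by move=> z0; rewrite truncn_le mulr_ge0. Qed.

Lemma floorn_itv z n : 0 <= z -> z * n%:R - 1 <= (floorn z n)%:R <= z * n%:R.
Proof.
move=> z0; rewrite floorn_le // andbT.
have /andP[_] := truncn_itv (mulr_ge0 z0 (ler0n R n)).
by rewrite -natr1 => /ltW; rewrite lerBlDr.
Qed.

(** What is required of [L = ln d]; the second clause is the only form in which
    exponentials are compared with polynomials below. *)
Definition large L := 16 * 16 * 16 * 10 <= L /\ (1 + L) ^+ 2 * expR (- (L / (16 * 16 * 8))) <= (10 * 10 * 10)^-1.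

Lemma eventually_large : exists L0, forall L, L0 <= L -> large L.
Proof.
(* A cubic lower bound for the exponential beats the square. *)
pose q : R := 3 * (16 * 16 * 8).
have q0 : 0 < q by rewrite /q; lra.
exists (16 * 16 * 16 * 10 + 4 * 10 * 10 * 10 * q ^+ 3) => L hL.
have q3 : 0 < q ^+ 3 by rewrite exprn_gt0.
have L1 : 16 * 16 * 16 * 10 <= L by lra.
have Lq : 4 * 10 * 10 * 10 * q ^+ 3 <= L by lra.
split=> //; rewrite expRN.
have e3 : (L / q) ^+ 3 <= expR (L / (16 * 16 * 8)).
  have -> : L / (16 * 16 * 8) = (L / q) * 3 by rewrite /q; field.
  rewrite -[3]/(3%:R) expRM_natr lerXn2r ?nnegrE ?expR_ge0 //.
    by rewrite divr_ge0 // ltW // ?q0 //; lra.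
  by apply: le_trans (expR_ge1Dx _); rewrite lerDr.
have e4 : 10 * 10 * 10 * (1 + L) ^+ 2 <= expR (L / (16 * 16 * 8)).
  apply: le_trans e3; rewrite expr_div_n ler_pdivlMr //.
  have h1 : (1 + L) ^+ 2 <= 4 * L ^+ 2 by nra.
  have L2 : 0 <= L ^+ 2 by rewrite exprn_ge0 //; lra.
  have -> : L ^+ 3 = L ^+ 2 * L by rewrite exprSr.
  have := ler_wpM2l L2 Lq; have := ler_wpM2r (ltW q3) h1; lra.
by rewrite ler_pdivrMr ?expR_gt0 //; lra.
Qed.

Lemma log_ge_eventually L0 : exists d0, forall d, (d0 <= d)%N -> (0 < d)%N /\ L0 <= ln (d%:R : R).
Proof.
exists (Num.bound (expR L0)).+1 => d hd; have d0 : (0 < d)%N by apply: leq_trans hd.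
split=> //; rewrite -(expRK L0) ler_ln ?posrE ?expR_gt0 ?ltr0n //.
apply: le_trans (ltW (archi_boundP (expR_ge0 _))) _.
by rewrite ler_nat ltnW.
Qed.

Section Fixed.
Variables (d : nat) (L : R).
Hypothesis dE : d%:R = expR L.
Hypothesis Llarge : large L.

Let u := expR (- (L / (16 * 16 * 8))).
Let eL := expR (- L).

Lemma deL : d%:R * eL = 1.
Proof. by rewrite dE /eL -expRD subrr expR0. Qed.

Lemma u_le : u <= (10 * 10 * 10)^-1 / (1 + L).
Proof.
have [h1 h2] := Llarge; rewrite ler_pdivlMr; last lra.
have u0 : 0 < u by rewrite /u expR_gt0.
by apply: le_trans h2; rewrite -/u; nra.
Qed.

(** With [x = r * ln d / d], the probability [(1 - 3 * x) ^ d] of escaping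
    domination is at least [d ^ (- 6 * r)], which beats the entropy of [x], of
    order [(ln d) ^ 2 / d], and that of [y = d ^ (- s)] as soon as
    [s > 6 * r]. *)
Lemma dominating_condition (r s : R) : 0 < r -> r <= 2^-1 -> s <= 2^-1 ->
  6 * r + (16 * 16 * 8)^-1 <= s ->
  let x := L * r * eL in let y := expR (- (L * s)) in
  [/\ 3 * x <= 2^-1, x + y <= 2^-1 &
      x * (1 + L) + y * (1 + L * s) < (1 - 3 * x) ^+ d / 2].
Proof.
move=> r0 r2 s2 rs x y; have [L1 L2] := Llarge; rewrite -/u in L2.
have u0 : 0 < u by rewrite /u expR_gt0.
(* [w = d ^ (- 6 * r)], the lower bound for the probability of escaping. *)
pose w := expR (- (6 * (L * r))).
have w0 : 0 < w by rewrite /w expR_gt0.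
have w1 : w <= 1 by rewrite /w le_1_expR //; nra.
have eLw : eL <= w * u by rewrite -expRD ler_expR; nra.
have yw : y <= w * u by rewrite -expRD ler_expR; nra.
have eL0 : 0 < eL by rewrite /eL expR_gt0.
have y0 : 0 < y by rewrite /y expR_gt0.
have wu : w * u <= u by rewrite ler_piMl // ltW.
have Lu : (1 + L) * u <= (10 * 10 * 10)^-1 by have := u_le; rewrite ler_pdivlMr //; lra.
have x3 : x <= (10 * 10 * 10)^-1.
  rewrite /x; apply: le_trans Lu.
  apply: le_trans (_ : (L * r) * u <= _).
    by rewrite ler_wpM2l ?(le_trans eLw) //; nra.
  by rewrite ler_wpM2r ?(ltW u0) //; nra.
have y3 : y <= (10 * 10 * 10)^-1 by apply: le_trans yw (le_trans wu (le_trans _ Lu)); nra.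
have x0 : 0 < x by rewrite /x !mulr_gt0 //; lra.
split; [lra|lra|].
have dx : d%:R * x = L * r by rewrite /x mulrCA deL mulr1.
have p1 : w <= (1 - 3 * x) ^+ d.
  have -> : w = expR (- (2 * (3 * x))) ^+ d.
    by rewrite -expRM_natl -/w /w mulrN; congr (expR (- _)); lra.
  rewrite lerXn2r ?nnegrE ?expR_ge0 //; first lra.
  by apply: expR_le_1B; lra.
have h1 : x * (1 + L) + y * (1 + L * s) <= (w * u) * (L * r * (1 + L) + (1 + L * s)).
  have e1 : x * (1 + L) <= (w * u) * (L * r * (1 + L)).
    have -> : x * (1 + L) = eL * (L * r * (1 + L)) by rewrite /x; ring.
    by rewrite ler_wpM2r // !mulr_ge0 //; lra.
  have e2 : y * (1 + L * s) <= (w * u) * (1 + L * s).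
    by rewrite ler_wpM2r //; nra.
  by rewrite [leRHS]mulrDr lerD.
have h2 : (w * u) * (L * r * (1 + L) + (1 + L * s)) <= w * (10 * 10 * 10)^-1.
  rewrite -mulrA ler_wpM2l ?(ltW w0) //; apply: le_trans L2.
  rewrite mulrC ler_wpM2r ?(ltW u0) //; nra.
by apply: le_lt_trans h1 (le_lt_trans h2 _); lra.
Qed.

Lemma rare_dominating_log (r s : R) (sq tq : nat -> nat) : L^-1 <= r -> r <= 2^-1 ->
  0 <= s -> s <= 2^-1 -> 6 * r + (16 * 16 * 8)^-1 <= s ->
  (forall n, (sq n)%:R <= L * r * eL * n%:R) ->
  (forall n, (tq n)%:R <= expR (- (L * s)) * n%:R) ->
  rare R d (fun n => bad_dominating (sq n) (tq n)).
Proof.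
move=> Lr r2 s0 s2 rs hs ht; have [L1 _] := Llarge.
have L0 : 0 < L by lra.
have r0 : 0 < r by apply: lt_le_trans Lr; rewrite invr_gt0.
have [c1 c2 c3] := dominating_condition r0 r2 s2 rs.
have eL0 : 0 < eL by rewrite /eL expR_gt0.
apply: (rare_dominating _ _ c1 c2 _ _ _ _ hs ht c3) => //.
- by rewrite !mulr_gt0.
- by rewrite expR_gt0.
- by rewrite ltW.
- by rewrite mulr_ge0 // ltW.
- rewrite -/eL ler_peMl ?(ltW eL0) //.
  by have := ler_wpM2l (ltW L0) Lr; rewrite mulfV // gt_eqF.
Qed.

Lemma e2_3 : expR (- 2) <= 3^-1 :> R.
Proof.
rewrite expRN lef_pV2 ?posrE ?expR_gt0 //.
by have := expR_ge1Dx (2 : R); lra.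
Qed.

Lemma rare_separated_log :
  let a := floorn (expR (- (L * 4^-1)) / 3) in
  rare R d (fun n => bad_separated (a n) (a n)).
Proof.
move=> a; have [L1 _] := Llarge.
set x := expR (- (L * 4^-1)) / 3.
have y0 : 0 < expR (- (L * 4^-1)) by rewrite expR_gt0.
have x0 : 0 < x by rewrite /x; lra.
have yu : expR (- (L * 4^-1)) <= u by rewrite ler_expR; lra.
have u1 : u <= (10 * 10 * 10)^-1.
  by apply: le_trans u_le _; rewrite ler_pdivrMr; lra.
(* [d * x = d ^ (3 / 4) / 3], and [12 <= expR 4] absorbs the constants. *)
apply: (@rare_separated _ d a x (L * 4^-1 + 2) (3 * (L * 4^-1) - 4)) => //.
- by rewrite /x; lra.
- lra.
- lra.
- by rewrite opprD expRD ler_wpM2l ?(ltW y0) // e2_3.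
- by move=> n; apply: floorn_itv; rewrite ltW.
- have e1 : 2 <= expR 1 :> R by have := expR_ge1Dx (1 : R); lra.
  have e4 : 16 <= expR 4 :> R.
    have -> : expR 4 = expR 1 ^+ 4 :> R by rewrite -expRM_natr mul1r.
    apply: le_trans (_ : 2 ^+ 4 <= _); first by rewrite -natrX ler_nat.
    by rewrite lerXn2r ?nnegrE ?expR_ge0 //.
  rewrite dE /x mulrA mulrAC -!expRD.
  have -> : L + - (L * 4^-1) + - (3 * (L * 4^-1) - 4) = 4 by field.
  lra.
- lra.
Qed.

Lemma rare_isolated_log :
  let a := floorn (L / (16 * 16) * eL) in let b := floorn (expR (- (L * (8 * 8 * 8)^-1)) / 3) in
  rare R d (fun n => bad_isolated (a n) (b n)).
Proof.
move=> a b; have [L1 L2] := Llarge; rewrite -/u in L2.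
have L0 : 0 < L by lra.
set y := expR (- (L * (8 * 8 * 8)^-1)) / 3.
have y'0 : 0 < expR (- (L * (8 * 8 * 8)^-1)) by rewrite expR_gt0.
have y'1 : expR (- (L * (8 * 8 * 8)^-1)) <= 1 by rewrite le_1_expR //; lra.
have eL0 : 0 < eL by rewrite /eL expR_gt0.
have u0 : 0 < u by rewrite /u expR_gt0.
have y0 : 0 < y by rewrite /y; lra.
have x0 : 0 < L / (16 * 16) * eL by rewrite !mulr_gt0 //; lra.
apply: (@rare_isolated _ d a b (L / (16 * 16) * eL) y L (L * (8 * 8 * 8)^-1 + 2)) => //.
- by rewrite /y; lra.
- lra.
- lra.
- by rewrite -/eL ler_peMl ?(ltW eL0) //; lra.
- by rewrite opprD expRD ler_wpM2l ?(ltW y'0) // e2_3.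
- by move=> n; apply: floorn_itv; rewrite ltW.
- by move=> n; apply: floorn_itv; rewrite ltW.
- have -> : d%:R * (L / (16 * 16) * eL * y) = L / (16 * 16) * y.
    by transitivity (d%:R * eL * (L / (16 * 16) * y)); [ring|rewrite deL mul1r].
  have eLy : eL <= 3 * y * u.
    have -> : 3 * y = expR (- (L * (8 * 8 * 8)^-1)) by rewrite /y; field.
    by rewrite -expRD ler_expR; lra.
  have h1 : eL * (1 + L) ^+ 2 <= 3 * y * (10 * 10 * 10)^-1.
    apply: le_trans (_ : 3 * y * u * (1 + L) ^+ 2 <= _).
      by rewrite ler_wpM2r // exprn_ge0 //; lra.
    by rewrite -mulrA (mulrC u) ler_wpM2l //; lra.
  have h2 : L / (16 * 16) * eL * (1 + L) <= eL * (1 + L) ^+ 2.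
    have -> : L / (16 * 16) * eL * (1 + L) = eL * (L / (16 * 16) * (1 + L)) by ring.
    by rewrite ler_wpM2l ?(ltW eL0) //; nra.
  have h3 : y * 1 <= y * (L / (8 * 8 * 8) - 3) by rewrite ler_wpM2l ?(ltW y0) //; lra.
  lra.
Qed.

Lemma rare_balanced_log :
  let k := floorn (5 * L * eL) in
  rare R d (fun n => bad_isolated (k n) (k n)).
Proof.
move=> k; have [L1 L2] := Llarge; rewrite -/u in L2.
have L0 : 0 < L by lra.
have eL0 : 0 < eL by rewrite /eL expR_gt0.
have u0 : 0 < u by rewrite /u expR_gt0.
have x0 : 0 < 5 * L * eL by rewrite !mulr_gt0 //; lra.
have eLu : eL <= u by rewrite /eL ler_expR; lra.
have := u_le; rewrite ler_pdivlMr => [Lu|]; last lra.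
apply: (@rare_isolated _ d k k (5 * L * eL) (5 * L * eL) L L) => //; try lra.
- by nra.
- by rewrite -/eL ler_peMl ?(ltW eL0) //; lra.
- by rewrite -/eL ler_peMl ?(ltW eL0) //; lra.
- by move=> n; apply: floorn_itv; rewrite ltW.
- by move=> n; apply: floorn_itv; rewrite ltW.
- have -> : d%:R * (5 * L * eL * (5 * L * eL)) = 5 * L * (5 * L * eL).
    by transitivity (d%:R * eL * (5 * L * (5 * L * eL))); [ring|rewrite deL mul1r].
  set X := 5 * L * eL in x0 *; nra.
Qed.

Let k := floorn (5 * L * eL).
Let a2 := floorn (L / (16 * 16) * eL).
Let y1 := expR (- (L * 4^-1)).
Let y2 := expR (- (L * (8 * 8 * 8)^-1)).
Let b2 := floorn (y2 / 3).
Let s2 := floorn (L * (16 * 16 * 16)^-1 * eL).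
Let t2 := floorn y2.
Let s1 n := ((a2 n).*2 + s2 n + (a2 n).*2)%N.
Let t1 := floorn y1.
Let a1 := floorn (y1 / 3).

(** The five exceptional events, in the order of their use: [k] bounds holes from
    above; [s1], [t1], [a1] give an induced path on [s1] vertices; [s2], [t2],
    [a2], [b2] close it through a middle part of [s2] vertices. *)
Definition atypical n : pred (sgraph n) := fun G =>
  [|| bad_isolated (k n) (k n) G, bad_dominating (s1 n) (t1 n) G,
      bad_separated (a1 n) (a1 n) G, bad_dominating (s2 n) (t2 n) G |
      bad_isolated (a2 n) (b2 n) G].

Lemma s1_le n : (s1 n)%:R <= L * 60^-1 * eL * n%:R.
Proof.
have [L1 _] := Llarge; have eL0 : 0 < eL by rewrite /eL expR_gt0.
have L0 : 0 < L by lra.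
have h2 : (a2 n)%:R <= L / (16 * 16) * eL * n%:R.
  by apply: floorn_le; rewrite !mulr_ge0 ?(ltW eL0) //; lra.
have h3 : (s2 n)%:R <= L * (16 * 16 * 16)^-1 * eL * n%:R.
  by apply: floorn_le; rewrite !mulr_ge0 ?(ltW eL0) //; lra.
have p : 0 <= L * eL * n%:R by rewrite !mulr_ge0 ?(ltW eL0) ?(ltW L0).
rewrite /s1 !natrD -!mul2n !natrM; lra.
Qed.

Lemma rare_atypical : rare R d atypical.
Proof.
have [L1 _] := Llarge.
have L0 : 0 < L by lra.
have eL0 : 0 < eL by rewrite /eL expR_gt0.
apply: rareU; first exact: rare_balanced_log.
apply: rareU.
  apply: (@rare_dominating_log 60^-1 4^-1); try lra.
  - by rewrite lef_pV2 ?posrE; lra.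
  - exact: s1_le.
  - by move=> n; apply: floorn_le; rewrite expR_ge0.
apply: rareU; first exact: rare_separated_log.
apply: rareU; last exact: rare_isolated_log.
apply: (@rare_dominating_log (16 * 16 * 16)^-1 (8 * 8 * 8)^-1); try lra.
- by rewrite lef_pV2 ?posrE; lra.
- by move=> n; apply: floorn_le; rewrite !mulr_ge0 ?(ltW eL0) //; lra.
- by move=> n; apply: floorn_le; rewrite expR_ge0.
Qed.

Lemma typical_hole : exists N, forall n, (N <= n)%N -> forall G : sgraph n,
  ~~ atypical G ->
  (2 * (16 * 16 * 16))^-1 * (n%:R * (L * eL)) <= (L_hole G)%:R <= 20 * (n%:R * (L * eL)).
Proof.
have [L1 L2] := Llarge; rewrite -/u in L2.
have L0 : 0 < L by lra.
have eL0 : 0 < eL by rewrite /eL expR_gt0.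
have u0 : 0 < u by rewrite /u expR_gt0.
have Le0 : 0 < L * eL by rewrite mulr_gt0.
have y10 : 0 < y1 by rewrite /y1 expR_gt0.
have y20 : 0 < y2 by rewrite /y2 expR_gt0.
have uL : u * (1 + L) <= (10 * 10 * 10)^-1.
  by have := u_le; rewrite ler_pdivlMr //; lra.
have u1 : u <= (10 * 10 * 10)^-1 by nra.
have y1u : y1 <= u by rewrite ler_expR; lra.
have y21 : y2 <= 2^-1.
  rewrite /y2 expRN lef_pV2 ?posrE ?expR_gt0 //.
  by apply: le_trans (expR_ge1Dx _); lra.
have eLy : eL <= y2 * u by rewrite -expRD ler_expR; lra.
have LeLy : L * eL <= y2 * (10 * 10 * 10)^-1.
  apply: le_trans (_ : y2 * (u * (1 + L)) <= _); last by rewrite ler_wpM2l // ltW.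
  by have := ler_wpM2l (ltW L0) eLy; have := mulr_gt0 y20 u0; lra.
have [N1 hN1] := eventually_ge (2 * (16 * 16 * 16)) Le0.
have [N2 hN2] := eventually_ge 6 y10.
have [N3 hN3] := eventually_ge 6 y20.
exists (maxn (maxn N1 N2) N3) => n; rewrite !geq_max => /andP[/andP[/hN1 n1 /hN2 n2] /hN3 n3] G.
rewrite /atypical !negb_or => /and5P[gk gd1 gs gd2 gi].
have n0 : 0 <= n%:R :> R by [].
have s1n := s1_le n.
have /andP[kl kh] : 5 * L * eL * n%:R - 1 <= (k n)%:R <= 5 * L * eL * n%:R.
  by apply: floorn_itv; lra.
have /andP[al ah] : L / (16 * 16) * eL * n%:R - 1 <= (a2 n)%:R <= L / (16 * 16) * eL * n%:R.
  by apply: floorn_itv; lra.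
have /andP[bl bh] : y2 / 3 * n%:R - 1 <= (b2 n)%:R <= y2 / 3 * n%:R.
  by apply: floorn_itv; lra.
have /andP[sl sh] : L * (16 * 16 * 16)^-1 * eL * n%:R - 1 <= (s2 n)%:R <=
    L * (16 * 16 * 16)^-1 * eL * n%:R.
  by apply: floorn_itv; lra.
have /andP[tl th] : y2 * n%:R - 1 <= (t2 n)%:R <= y2 * n%:R by apply: floorn_itv; lra.
have /andP[tl1 th1] : y1 * n%:R - 1 <= (t1 n)%:R <= y1 * n%:R by apply: floorn_itv; lra.
have /andP[al1 ah1] : y1 / 3 * n%:R - 1 <= (a1 n)%:R <= y1 / 3 * n%:R.
  by apply: floorn_itv; lra.
have LeLn := ler_wpM2r n0 LeLy.
have y2n := ler_wpM2r n0 y21.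
have y1n := ler_wpM2r n0 (le_trans y1u u1).
apply/andP; split.
  have s2L : (s2 n <= L_hole G)%N.
    apply: (@long_hole n G _ (a2 n) (b2 n) (t2 n)) => //.
    - apply: (exists_ipath gd1 gs).
        rewrite -(ler_nat R) natrD; lra.
      rewrite -(ler_nat R) natrD; lra.
    - rewrite -(ler_nat R) natrD; lra.
    - rewrite -(ler_nat R); lra.
    - rewrite -(ler_nat R) natrD -!mul2n !natrM; lra.
  rewrite -(ler_nat R) in s2L; apply: le_trans s2L; lra.
have kL : (L_hole G < (k n).*2.*2)%N.
  rewrite ltnNge; apply: contra gk; apply: long_hole_isolated.
  rewrite -(ltr_nat R); lra.
have : (L_hole G)%:R <= ((k n).*2.*2)%:R :> R by rewrite ler_nat ltnW.
rewrite -!mul2n !natrM; lra.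
Qed.

End Fixed.
End Rates.

Local Open Scope classical_set_scope.
Local Open Scope ring_scope.

Theorem theorem1p4 (R : realType) :
  exists (c C : R) (d0 : nat),
    [/\ 0 < c, c < C &
      forall d : nat, (d0 <= d)%N ->
        prob_regular R d (fun G : sgraph n =>
          c * (n%:R * ln d%:R / d%:R) <= (L_hole G)%:R
            <= C * (n%:R * ln d%:R / d%:R))
        @[n --> within [set n : nat | ~~ odd (n * d)] \oo] --> (1 : R)].
Proof.
exists (2 * (16 * 16 * 16))^-1, 20.
have [L0 hL0] := eventually_large R; have [d0 hd0] := log_ge_eventually L0.
exists d0; split; [lra|lra|] => d /hd0[d_gt0 dL].
have {L0 hL0 d0 hd0 dL} Ll := hL0 _ dL; set L := ln _ in Ll.
have dE : d%:R = expR L by rewrite lnK ?posrE ?ltr0n.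
have edE : (d%:R : R)^-1 = expR (- L) by rewrite expRN dE.
have [N1 hN1] := typical_hole Ll.
apply/cvgrPdist_le => e e0; have [N2 hN2] := rare_atypical dE Ll e0.
rewrite near_withinE; exists (maxn (maxn N1 N2) d.+1) => // n /=.
rewrite !geq_max => /andP[/andP[/hN1 typ /hN2 rar] dn] par.
rewrite /prob_regular.
pose good (G : sgraph n) :=
  (2 * (16 * 16 * 16))^-1 * (n%:R * ln d%:R / d%:R : R) <= (L_hole G)%:R
    <= 20 * (n%:R * ln d%:R / d%:R : R).
change (`|1 - #|[set G : sgraph n | regular G d && good G]%SET|%:R /
              #|[set G : sgraph n | regular G d]%SET|%:R| <= e).
have goodE G : ~~ atypical L G -> good G.
  by move/typ; rewrite /good -(mulrA n%:R) edE.
have [G0 regG0] := exists_regular dn par.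
have TE : count_regular d (@predT (sgraph n)) = #|[set G : sgraph n | regular G d]%SET|.
  by apply: eq_card => G; rewrite !inE andbT.
have T0 : (0 < #|[set G : sgraph n | regular G d]%SET|)%N.
  by apply/card_gt0P; exists G0; rewrite inE.
have XT : (#|[set G : sgraph n | regular G d && good G]%SET| <=
    #|[set G : sgraph n | regular G d]%SET|)%N.
  by apply/subset_leq_card/fintype.subsetP => G; rewrite !inE => /andP[].
have TX : (#|[set G : sgraph n | regular G d]%SET| <=
    #|[set G : sgraph n | regular G d && good G]%SET| + count_regular d (@atypical R L n))%N.
  apply: leq_trans (leq_card_setU _ _).
  apply/subset_leq_card/fintype.subsetP => G; rewrite !inE => ->.
  by case: (boolP (atypical L G)) => [|/goodE ->]; rewrite ?orbT.
rewrite TE in rar.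
rewrite -(ltr_nat R) in T0; rewrite -(ler_nat R) in XT; rewrite -(ler_nat R) natrD in TX.
rewrite ger0_norm; last by rewrite subr_ge0 ler_pdivrMr // mul1r.
by rewrite lerBlDr -lerBlDl ler_pdivlMr // mulrBl mul1r lerBlDr (le_trans TX) // lerD2l.
Qed.
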